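(* Let $G$ be a (finite, simple) graph, regarded as a simplicial complex of dimension at most $1$ on vertex set $[n]$. Then $\mathrm{cat}(\mathcal Z_G)\leq 2$. Thus $G$ is $2$-annihilating over $\mathbb Z$, and all Massey products of decomposable elements in $\mathrm{Tor}^+_{\mathbb Z[v_1,\ldots,v_n]}(\mathbb Z[G],\mathbb Z)$ vanish.
   Context: Simplicial complexes have no ghost vertices. $\mathcal Z_K=\bigcup_{\sigma\in K}Y_1^\sigma\times\cdots\times Y_n^\sigma\subseteq (D^2)^{\times n}$ with $Y_i^\sigma=D^2$ if $i\in\sigma$ and $Y_i^\sigma=\partial D^2$ if $i\notin\sigma$. $\mathrm{cat}(X)$ is the smallest $k$ such that $X$ is covered by $k+1$ open sets each with nullhomotopic inclusion into $X$. $\mathrm{Tor}_{\mathbb Z[v_1,\ldots,v_n]}(\mathbb Z[K],\mathbb Z)$, where $\mathbb Z[K]$ is the Stanley-Reisner ring, is the cohomology algebra of the Koszul DGA $\Lambda[u_1,\ldots,u_n]\otimes\mathbb Z[K]$, $du_i=v_i$; it is isomorphic to $H^*(\mathcal Z_K;\mathbb Z)$ via a quasi-isomorphism of DGAs with cellular cochains. $\mathrm{Tor}^+$ is the positive degree part; an element of it is decomposable if it is a product of two or more elements of $\mathrm{Tor}^+$. $\mathrm{nill}\,A$ is the smallest $k$ such that all length $k$ products in $A^+$ vanish. $K$ is $m$-annihilating over $\mathbb Z$ if (1) $\mathrm{nill}(\mathrm{Tor}_{\mathbb Z[v_1,\ldots,v_n]}(\mathbb Z[K],\mathbb Z))\leq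 m+1$; and (2) Massey products $\langle w_1,\ldots,w_k\rangle$ vanish in $\mathrm{Tor}^+$ whenever $w_i=a_1\cdots a_{m_i}$ and $w_j=b_1\cdots b_{m_j}$, and $m_i+m_j>m$ for some odd $i$ and even $j$ and $a_s,b_t\in\mathrm{Tor}^+$. A Massey product vanishes if, whenever it is defined, it contains $0$. *)

(* Defs.v *)
From HB Require Import structures.
From mathcomp Require Import all_boot all_order all_algebra.
From mathcomp Require Import generic_quotient ring_quotient boolp.
From mathcomp Require Import ring.
From mathcomp Require mpoly.

Set Implicit Arguments.
Unset Strict Implicit.
Unset Printing Implicit Defensive.

Import Order.TTheory GRing.Theory Num.Theory.

Local Open Scope ring_scope.
Local Open Scope quotient_scope.

(* [inversions S T] counts the pairs (i, j) in S x T with j < i, so that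
   u_S u_T = (-1) ^ inversions S T u_(S :|: T) for disjoint S and T. *)
Section SetSign.
Context {n : nat}.
Implicit Types (S T U : {set 'I_n}) (j : 'I_n).

Definition nbelow S j : nat := \sum_(i in S) (i < j)%N.
Definition nabove S j : nat := \sum_(i in S) (j < i)%N.
Definition inversions S T : nat := \sum_(i in S) nbelow T i.

Lemma sum_setU1 (S : {set 'I_n}) j (F : 'I_n -> nat) : j \notin S ->
  (\sum_(i in j |: S) F i = F j + \sum_(i in S) F i)%N.
Proof. by move=> jS; rewrite big_setU1. Qed.

Lemma sum_disjU (S T : {set 'I_n}) (F : 'I_n -> nat) : [disjoint S & T] ->
  (\sum_(i in S :|: T) F i = \sum_(i in S) F i + \sum_(i in T) F i)%N.
Proof.
by move=> dST; rewrite -bigU //=; apply: eq_bigl => i; rewrite !inE.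
Qed.

Lemma nbelow_above S j : j \notin S -> (nbelow S j + nabove S j = #|S|)%N.
Proof.
move=> jS; rewrite -sum1_card -big_split /=; apply: eq_bigr => i iS.
have : i != j by apply: contraNneq jS => <-.
by rewrite -val_eqE /=; case: (ltngtP i j).
Qed.

Lemma inversionsUl S T U : [disjoint S & T] ->
  (inversions (S :|: T) U = inversions S U + inversions T U)%N.
Proof. exact: sum_disjU. Qed.

Lemma inversionsUr S T U : [disjoint T & U] ->
  (inversions S (T :|: U) = inversions S T + inversions S U)%N.
Proof.
move=> dTU; rewrite -big_split; apply: eq_bigr => i _; exact: sum_disjU.
Qed.

Lemma inversions1l S j T : j \notin S ->
  (inversions (j |: S) T = nbelow T j + inversions S T)%N.
Proof. exact: sum_setU1. Qed.

Lemma inversions1r S j T : j \notin T ->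
  (inversions S (j |: T) = nabove S j + inversions S T)%N.
Proof.
by move=> jT; rewrite -big_split; apply: eq_bigr => i _; rewrite [LHS]sum_setU1.
Qed.

Lemma inversions0l S : inversions set0 S = 0%N.
Proof. exact: big_set0. Qed.

Lemma inversions0r S : inversions S set0 = 0%N.
Proof. by rewrite /inversions big1 // => i _; exact: big_set0. Qed.

End SetSign.

(* The exterior algebra over A on u_0, .., u_(n-1), that is,
   Lambda[u_0, .., u_(n-1)] (x) A: the function x stands for the sum of the
   x S u_S, where u_S is the increasing product of the u_i with i in S. *)
Definition exterior (n : nat) (A : comNzRingType) := {ffun {set 'I_n} -> A}.

Section Exterior.
Context {n : nat} {A : comNzRingType}.
Local Notation E := (exterior n A).
Implicit Types (x y z : E) (S I J : {set 'I_n}).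

HB.instance Definition _ := GRing.Zmodule.on E.

Definition ext_mul x y : E :=
  [ffun S : {set 'I_n} => \sum_(I : {set 'I_n} | I \subset S)
     (-1) ^+ inversions I (S :\: I) * (x I * y (S :\: I))].
Definition ext_one : E := [ffun S => (S == set0)%:R].

Lemma ext_mul1 : left_id ext_one ext_mul.
Proof.
move=> x; apply/ffunP => S; rewrite ffunE (bigD1 set0) ?sub0set //=.
rewrite big1 => [|I /andP[_ /negPf I0]].
  by rewrite ffunE eqxx setD0 inversions0l mul1r mul1r addr0.
by rewrite ffunE I0 mul0r mulr0.
Qed.

Lemma ext_mulr1 : right_id ext_one ext_mul.
Proof.
move=> x; apply/ffunP => S; rewrite ffunE (bigD1 S) ?subxx //=.
rewrite big1 => [|I /andP[IS nIS]].
  by rewrite ffunE setDv eqxx inversions0r mul1r mulr1 addr0.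
rewrite ffunE setD_eq0 [_ \subset _]negbTE ?mulr0 //.
by apply: contraNN nIS; rewrite eqEsubset IS.
Qed.

Lemma ext_mulDl : left_distributive ext_mul +%R.
Proof.
move=> x y z; apply/ffunP => S; rewrite !ffunE -big_split /=.
by apply: eq_bigr => I _; rewrite ffunE mulrDl mulrDr.
Qed.

Lemma ext_mulDr : right_distributive ext_mul +%R.
Proof.
move=> x y z; apply/ffunP => S; rewrite !ffunE -big_split /=.
by apply: eq_bigr => I _; rewrite ffunE mulrDr mulrDr.
Qed.

Lemma ext_mulA : associative ext_mul.
Proof.
move=> x y z; apply/ffunP => S; rewrite !ffunE.
under [RHS]eq_bigr => J JS.
  rewrite ffunE mulr_suml mulr_sumr.
  over.
rewrite [RHS](exchange_big_dep (fun I : {set 'I_n} => I \subset S)) /=; last first.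
  by move=> J I JS IJ; exact: subset_trans IJ JS.
apply: eq_bigr => I IS; rewrite ffunE 2!mulr_sumr.
rewrite [RHS](reindex_onto (fun L => I :|: L) (fun J => J :\: I)) /=; last first.
  by move=> J /andP[_ IJ]; rewrite setDE setUIr setUCr setIT; apply/setUidPr.
have cond L : ((I :|: L \subset S) && (I \subset I :|: L) &&
    ((I :|: L) :\: I == L)) = (L \subset S :\: I).
  rewrite subsetUl andbT setDUl setDv set0U subUset IS /= subsetD.
  by congr (_ && _); exact: sameP eqP setDidPl.
rewrite (eq_bigl _ _ cond) /=; apply: eq_bigr => L.
rewrite subsetD => /andP[LS dLI]; have dIL : [disjoint I & L].
  by rewrite disjoint_sym.
have eD : (I :|: L) :\: I = L by rewrite setDUl setDv set0U; exact/setDidPl.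
rewrite eD setDDl inversionsUl //.
have eS : S :\: I = L :|: S :\: (I :|: L).
  apply/setP => i; rewrite !inE.
  case iI: (i \in I) => //=; last by case: (boolP (i \in L)) => //= /(subsetP LS).
  by rewrite orbF; apply/esym/negbTE; rewrite (disjointFr dIL iI).
rewrite {1}eS inversionsUr; last first.
  by rewrite disjoint_sym disjoints_subset; apply/subsetP => i; rewrite !inE; case: (i \in L); rewrite ?orbT ?andbF.
rewrite !exprD; set a := _ ^+ _; set b := _ ^+ _; set c := _ ^+ _.
move: (x I) (y L) (z _) => p q r.
ring.
Qed.

Lemma ext_one_neq0 : ext_one != 0.
Proof.
by apply/eqP => /ffunP /(_ set0); rewrite !ffunE eqxx => /eqP; rewrite oner_eq0.
Qed.

HB.instance Definition _ := GRing.Zmodule_isNzRing.Build E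
  ext_mulA ext_mul1 ext_mulr1 ext_mulDl ext_mulDr ext_one_neq0.

(* The A-linear derivation d with d u_i = v i: removing j from u_(j |: S)
   moves u_j past the nbelow S j generators in front of it. *)
Definition koszul_d (v : 'I_n -> A) x : E :=
  [ffun S : {set 'I_n} =>
     \sum_(j | j \notin S) (-1) ^+ nbelow S j * (v j * x (j |: S))].

Lemma extM x y S : (x * y) S = \sum_(I : {set 'I_n} | I \subset S)
     (-1) ^+ inversions I (S :\: I) * (x I * y (S :\: I)).
Proof. by rewrite ffunE. Qed.

Section Differential.
Variable v : 'I_n -> A.
Local Notation d := (koszul_d v).

Lemma koszul_dB x y : d (x - y) = d x - d y.
Proof.
apply/ffunP => S; rewrite !ffunE -sumrB; apply: eq_bigr => j _.
by rewrite !ffunE !mulrBr.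
Qed.

Lemma koszul_dd x : d (d x) = 0.
Proof.
apply/ffunP => S; rewrite !ffunE.
pose F j k : A := (-1) ^+ nbelow S j *
   (v j * ((-1) ^+ nbelow (j |: S) k * (v k * x (k |: (j |: S))))).
transitivity (\sum_(j | j \notin S) \sum_(k | k \notin S)
   if k == j then 0 else F j k).
  apply: eq_bigr => j jS; rewrite ffunE !mulr_sumr.
  rewrite [RHS]big_mkcond [LHS]big_mkcond /=; apply: eq_bigr => k _.
  rewrite !inE negb_or; case: eqP => //= _; first by case: ifP.
have Fanti j k : j \notin S -> k \notin S -> (j < k)%N -> F j k = - F k j.
  move=> jS kS jk; rewrite /F /nbelow !sum_setU1 // jk ltnNge ltnW //= add0n.
  rewrite setUCA exprD expr1.
  move: (x _) (v j) (v k) (_ ^+ _) (_ ^+ _) => X V W s t.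
  ring.
pose P (j k : 'I_n) : A := if (j < k)%N then F j k else 0.
transitivity (\sum_(j | j \notin S) \sum_(k | k \notin S) (P j k - P k j)).
  apply: eq_bigr => j jS; apply: eq_bigr => k kS; rewrite /P.
  rewrite -val_eqE /=; case: (ltngtP j k) => [jk|kj|_]; rewrite ?subr0 //.
  by rewrite sub0r (Fanti k j) // opprK.
under eq_bigr do rewrite sumrB.
by rewrite sumrB exchange_big subrr.
Qed.

Definition ext_bar x : E := [ffun S : {set 'I_n} => (-1) ^+ #|S| * x S].

Lemma koszul_leibniz x y : d (x * y) = d x * y + ext_bar x * d y.
Proof.
apply/ffunP => S; rewrite ffunE [RHS]ffunE !extM /=.
pose L1 I j : A := (-1) ^+ (nbelow S j + inversions (j |: I) (S :\: I)) *
  (v j * (x (j |: I) * y (S :\: I))).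
pose L2 I j : A := (-1) ^+ (nbelow S j + inversions I (j |: S :\: I)) *
  (v j * (x I * y (j |: S :\: I))).
transitivity (\sum_(I : {set _} | I \subset S) \sum_(j | j \notin S) L1 I j
   + \sum_(I : {set _} | I \subset S) \sum_(j | j \notin S) L2 I j).
  rewrite [X in _ = X + _]exchange_big [X in _ = _ + X]exchange_big /=.
  rewrite -big_split /=; apply: eq_bigr => j jS.
  rewrite extM (bigID (fun I : {set 'I_n} => j \in I)) /= 2!mulrDr.
  congr (_ + _).
    rewrite (reindex_onto (fun I => j |: I) (fun I => I :\ j)) /=; last first.
      by move=> I /andP[_ jI]; rewrite setD1K.
    rewrite !mulr_sumr; apply: eq_big => [I|I].
      rewrite subUset sub1set !setU11 /= andbT; case: (boolP (j \in I)) => jI.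
        rewrite [RHS]negbTE; last by apply: contraNN jS => /subsetP /(_ _ jI).
        apply/negbTE; rewrite negb_and orbC; apply/orP; left; apply/eqP => e.
        by move: jI; rewrite -e !inE eqxx.
      rewrite setU1K // eqxx andbT; apply/idP/idP; last first.
        by move=> h; exact: subset_trans h (subsetUr _ _).
      move=> /subsetP IS; apply/subsetP => i iI; have := IS _ iI.
      by rewrite !inE => /orP[/eqP e|//]; rewrite e (negPf jI) in iI.
    case/andP => _ /eqP e.
    have jI : j \notin I by rewrite -e !inE eqxx.
    rewrite /L1; have -> : (j |: S) :\: (j |: I) = S :\: I.
      apply/setP => i; rewrite !inE; case: eqP => //= ->.
      by rewrite (negPf jS) andbF.
    by rewrite exprD -!mulrA; congr (_ * _); rewrite mulrCA.
  rewrite !mulr_sumr; apply: eq_big => [I|I].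
    apply/andP/idP => [[/subsetP IS jI]|IS]; last first.
      split; first exact: subset_trans IS (subsetUr _ _).
      by apply: contraNN jS => /(subsetP IS).
    apply/subsetP => i iI; have := IS _ iI.
    by rewrite !inE => /orP[/eqP e|//]; rewrite -e iI in jI.
  case/andP => _ jI; rewrite /L2.
  have -> : (j |: S) :\: I = j |: S :\: I.
    by apply/setP => i; rewrite !inE; case: eqP => //= ->; rewrite jI.
  by rewrite exprD -!mulrA; congr (_ * _); rewrite mulrCA.
pose M1 I j : A := (-1) ^+ (inversions I (S :\: I) + nbelow I j) *
  (v j * (x (j |: I) * y (S :\: I))).
pose M2 I j : A := (-1) ^+ (#|I| + inversions I (S :\: I) + nbelow (S :\: I) j) *
  (v j * (x I * y (j |: S :\: I))).
transitivity (\sum_(I : {set _} | I \subset S) \sum_(j | j \notin I) M1 I j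
   + \sum_(I : {set _} | I \subset S) \sum_(j | j \notin S :\: I) M2 I j);
   last first.
  congr (_ + _); apply: eq_bigr => I IS; rewrite ffunE.
    rewrite mulr_suml mulr_sumr; apply: eq_bigr => j _.
    by rewrite /M1 exprD -!mulrA.
  rewrite ffunE mulr_sumr mulr_sumr; apply: eq_bigr => j _.
  by rewrite /M2 !exprD; ring.
under [X in _ = X + _]eq_bigr => I IS do rewrite (bigID (fun j => j \in S)) /=.
under [X in _ = _ + X]eq_bigr => I IS do rewrite (bigID (fun j => j \in S)) /=.
rewrite !big_split /= addrACA.
have -> : \sum_(I : {set 'I_n} | I \subset S)
    \sum_(j | (j \notin I) && (j \in S)) M1 I j +
  \sum_(I : {set 'I_n} | I \subset S)
    \sum_(j | (j \notin S :\: I) && (j \in S)) M2 I j = 0.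
  rewrite (exchange_big_dep (fun j => j \in S)) /=; last by move=> I j _ /andP[].
  rewrite [X in _ + X](exchange_big_dep (fun j => j \in S)) /=; last first.
    by move=> I j _ /andP[].
  rewrite -big_split /= big1 // => j jS.
  rewrite [X in _ + X](reindex_onto (fun I => j |: I) (fun I => I :\ j)) /=; last first.
    move=> I /andP[_ /andP[+ _]]; rewrite !inE jS andbT negbK => jI.
    by rewrite setD1K.
  rewrite [X in X + _](eq_bigl (fun I : {set 'I_n} => (I \subset S) && (j \notin I))); last first.
    by move=> I; rewrite jS andbT.
  rewrite [X in _ + X](eq_bigl (fun I : {set 'I_n} => (I \subset S) && (j \notin I))); last first.
    move=> I; rewrite subUset sub1set jS !inE eqxx /= andbT; congr (_ && _).
    apply/eqP/idP => [<-|jI]; first by rewrite !inE eqxx.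
    by rewrite setU1K.
  rewrite -big_split /= big1 // => I /andP[IS jI]; rewrite /M1 /M2.
  pose T := S :\: (j |: I); have jT : j \notin T by rewrite !inE eqxx.
  have eT : S :\: I = j |: T.
    by apply/setP => i; rewrite !inE; case: eqP => //= ->; rewrite jI.
  rewrite -/T -eT inversions1l // eT inversions1r // cardsU1 jI.
  rewrite -(nbelow_above jI).
  set X := v j * _; rewrite -mulrDl.
  rewrite -[X in X + _]signr_odd -[X in _ + X]signr_odd !oddD /=.
  case: (odd (nbelow T j)); case: (odd (nabove I j)); case: (odd (nbelow I j)); case: (odd (inversions I T)); rewrite /= ?expr0 ?expr1 ?subrr ?addNr ?mul0r //.
have nbS (I : {set 'I_n}) j : I \subset S ->
    nbelow S j = (nbelow I j + nbelow (S :\: I) j)%N.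
  move=> IS; rewrite -[in LHS](setID S I) (setIidPr IS) /nbelow sum_disjU //.
  rewrite disjoint_sym disjoints_subset; apply/subsetP => i.
  by rewrite !inE => /andP[].
rewrite add0r; congr (_ + _); apply: eq_bigr => I IS.
  apply: eq_big => [j|j jS].
    apply/idP/andP => [jS|[]//]; split=> //.
    by apply: contraNN jS; exact: (subsetP IS).
  have jI : j \notin I by apply: contraNN jS; exact: (subsetP IS).
  rewrite /L1 /M1; congr (_ * _).
  rewrite inversions1l // (nbS _ _ IS) -[LHS]signr_odd -[RHS]signr_odd !oddD.
  by congr (_ ^+ (nat_of_bool _)); case: (odd _); case: (odd _); case: (odd _).
apply: eq_big => [j|j jS].
  by rewrite !inE; case: (boolP (j \in S)); rewrite ?andbF ?andbT.
have jI : j \notin I by apply: contraNN jS; exact: (subsetP IS).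
rewrite /L2 /M2; congr (_ * _).
rewrite inversions1r ?inE ?(negPf jS) ?andbF // (nbS _ _ IS) -(nbelow_above jI).
rewrite -[LHS]signr_odd -[RHS]signr_odd !oddD; congr (_ ^+ (nat_of_bool _)).
by case: (odd _); case: (odd _); case: (odd _); case: (odd _).
Qed.

End Differential.
End Exterior.

(* Differential graded rings, graded by the natural numbers with a differential
   of degree +1; [degree k x] says that x is homogeneous of degree k (so 0 has
   every degree), and the last two axioms on degree say that the ring is the
   direct sum of its homogeneous components. *)
Record dga := DGA {
  dga_ring :> nzRingType;
  degree : nat -> dga_ring -> Prop;
  dga_d : dga_ring -> dga_ring;
  degree0 : forall k, degree k 0;
  degreeB : forall k x y, degree k x -> degree k y -> degree k (x - y);
  degree1 : degree 0%N 1;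
  degreeM : forall k l x y, degree k x -> degree l y -> degree (k + l) (x * y);
  degree_total : forall x, exists N (y : nat -> dga_ring),
    (forall k, degree k (y k)) /\ x = \sum_(k < N) y k;
  degree_free : forall N (y : nat -> dga_ring), (forall k, degree k (y k)) ->
    \sum_(k < N) y k = 0 -> forall k, (k < N)%N -> y k = 0;
  dga_dB : {morph dga_d : x y / x - y};
  degree_d : forall k x, degree k x -> degree k.+1 (dga_d x);
  dga_dd : forall x, dga_d (dga_d x) = 0;
  leibniz : forall k x y, degree k x ->
    dga_d (x * y) = dga_d x * y + (-1) ^+ k * (x * dga_d y)
}.

Section Cohomology.
Variable C : dga.
Local Notation d := (@dga_d C).

HB.instance Definition _ := GRing.isZmodMorphism.Build C C d (@dga_dB C).

Definition cocycle : {pred C} := [pred x | d x == 0].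

Lemma cocycleP x : reflect (d x = 0) (x \in cocycle).
Proof. by rewrite inE; exact: eqP. Qed.

Lemma dga_d1 : d 1 = 0.
Proof.
have := leibniz 1 (degree1 C); rewrite expr0 !mulr1 !mul1r => /eqP.
by rewrite -subr_eq subrr eq_sym => /eqP.
Qed.

Lemma d_mul_cocycle x y : d y = 0 -> d (x * y) = d x * y.
Proof.
move=> dy; have [N [z [hz ->]]] := degree_total x.
rewrite mulr_suml !raddf_sum mulr_suml; apply: eq_bigr => k _ /=.
by rewrite (leibniz y (hz k)) dy !mulr0 addr0.
Qed.

Lemma cocycle_mul_d x y : d x = 0 -> exists z, x * d y = d z.
Proof.
have [N [z [hz ->]]] := degree_total x => dz.
exists (\sum_(k < N) (-1) ^+ k * (z k * y)).
rewrite raddf_sum mulr_suml; apply: eq_bigr => k _ /=.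
have d0 : forall i, degree i (if i is i'.+1 then d (z i') else 0 : C).
  by case=> [|i]; [exact: degree0 | exact/degree_d].
have zk0 : d (z k) = 0.
  apply: (degree_free (N := N.+1) d0 _ (k := k.+1)); rewrite ?ltnS //.
  by rewrite big_ord_recl add0r -[RHS]dz raddf_sum.
have dsgn (i : nat) (u : C) : d ((-1) ^+ i * u) = (-1) ^+ i * d u.
  by rewrite -signr_odd !mulr_sign; case: odd; rewrite ?raddfN.
by rewrite dsgn (leibniz y (hz k)) zk0 mul0r add0r signrMK.
Qed.

Lemma cocycle_subring : subring_closed cocycle.
Proof.
split=> [|x y /cocycleP dx /cocycleP dy|x y /cocycleP dx /cocycleP dy].
- by apply/cocycleP; exact: dga_d1.
- by apply/cocycleP; rewrite dga_dB dx dy subr0.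
- by apply/cocycleP; rewrite d_mul_cocycle // dx mul0r.
Qed.

HB.instance Definition _ := GRing.isSubringClosed.Build C cocycle cocycle_subring.

Record cocycles := Cocycle { cocycle_val :> C; _ : cocycle_val \in cocycle }.

HB.instance Definition _ := [isSub for cocycle_val].
HB.instance Definition _ := [Choice of cocycles by <:].
HB.instance Definition _ := [SubChoice_isSubNzRing of cocycles by <:].

Definition coboundary : {pred cocycles} :=
  [pred x : cocycles | `[< exists y : C, val x = d y >]].

Lemma coboundaryP (x : cocycles) :
  reflect (exists y, val x = d y) (x \in coboundary).
Proof. exact: asboolP. Qed.

Lemma coboundary_zmod : zmod_closed coboundary.
Proof.
split=> [|x y /coboundaryP[u xu] /coboundaryP[v yv]]; apply/coboundaryP.
  by exists 0; rewrite !raddf0.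
by exists (u - v); rewrite dga_dB -xu -yv raddfB.
Qed.

HB.instance Definition _ :=
  GRing.isZmodClosed.Build cocycles coboundary coboundary_zmod.

Lemma coboundaryMl (x y : cocycles) :
  y \in coboundary -> x * y \in coboundary.
Proof.
case/coboundaryP => u yu; apply/coboundaryP.
rewrite rmorphM /= yu; apply: cocycle_mul_d; exact/cocycleP/valP.
Qed.

Lemma coboundaryMr (x y : cocycles) :
  x \in coboundary -> x * y \in coboundary.
Proof.
case/coboundaryP => u xu; apply/coboundaryP; exists (u * val y).
rewrite rmorphM /= xu d_mul_cocycle //; exact/cocycleP/valP.
Qed.

Definition cohomology := Quotient.quot coboundary.

HB.instance Definition _ := GRing.Zmodule.on cohomology.
HB.instance Definition _ := EqQuotient.on cohomology.
HB.instance Definition _ : isZmodQuotient _ _ _ _ _ cohomology := ZmodQuotient.on cohomology.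

Definition cohomology_one : cohomology := \pi_cohomology 1.
Definition cohomology_mul := lift_op2 cohomology *%R.

Lemma pi_cohomologyM (x y : cocycles) :
  cohomology_mul (\pi_cohomology x) (\pi_cohomology y) = \pi_cohomology (x * y).
Proof.
unlock cohomology_mul; apply/eqP; rewrite -[_ == _]Quotient.idealrBE.
set x' := repr _; set y' := repr _.
have ->: x' * y' - x * y = x' * (y' - y) + (x' - x) * y.
  by rewrite mulrBr mulrBl addrA subrK.
apply: rpredD; [apply: coboundaryMl | apply: coboundaryMr];
by rewrite Quotient.idealrBE reprK.
Qed.

Lemma cohomology_mulA : associative cohomology_mul.
Proof.
move=> x y z; rewrite -[x]reprK -[y]reprK -[z]reprK.
by rewrite !pi_cohomologyM mulrA.
Qed.

Lemma cohomology_mul1 : left_id cohomology_one cohomology_mul.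
Proof. by move=> x; rewrite -[x]reprK pi_cohomologyM mul1r. Qed.

Lemma cohomology_mulr1 : right_id cohomology_one cohomology_mul.
Proof. by move=> x; rewrite -[x]reprK pi_cohomologyM mulr1. Qed.

Lemma cohomology_mulDl : left_distributive cohomology_mul +%R.
Proof.
move=> x y z; rewrite -[x]reprK -[y]reprK -[z]reprK.
by rewrite -raddfD !pi_cohomologyM -raddfD mulrDl.
Qed.

Lemma cohomology_mulDr : right_distributive cohomology_mul +%R.
Proof.
move=> x y z; rewrite -[x]reprK -[y]reprK -[z]reprK.
by rewrite -raddfD !pi_cohomologyM -raddfD mulrDr.
Qed.

HB.instance Definition _ := GRing.Zmodule_isPzRing.Build cohomology
  cohomology_mulA cohomology_mul1 cohomology_mulr1
  cohomology_mulDl cohomology_mulDr.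

(* [represents x w]: x is a cocycle, and w is its class. *)
Definition represents (x : C) (w : cohomology) : Prop :=
  exists z : cocycles, val z = x /\ \pi_cohomology z = w.

Definition has_degree (k : nat) (w : cohomology) : Prop :=
  exists x : C, degree k x /\ represents x w.

End Cohomology.

Section Massey.
Context {C : dga}.
Local Notation H := (cohomology C).
Implicit Types (w : nat -> H) (p : nat -> nat) (a : nat -> nat -> C).

(* H^+: sums of classes of positive degrees. *)
Definition in_plus (x : H) : Prop :=
  exists N (y : nat -> H),
    (forall i, has_degree i.+1 (y i)) /\ x = \sum_(i < N) y i.

Definition is_product (m : nat) (x : H) : Prop :=
  exists a : 'I_m -> H, (forall i, in_plus (a i)) /\ x = \prod_(i < m) a i.

Definition decomposable (x : H) : Prop :=
  exists m, (2 <= m)%N /\ is_product m x.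

(* Massey products <w_1, .., w_k> of homogeneous classes: only the values w i,
   p i and a i j with 1 <= i <= j <= k matter, and p i is the degree of w i.
   A defining system has a i i representing w i, and
     d (a i j) = \sum_(i <= r < j) (- 1) ^ (1 + deg (a i r)) a i r * a (r + 1) j
   for (i, j) <> (1, k), where deg (a i j) = p i + .. + p j - (j - i); this
   truncated subtraction is exact as every p i is positive.  Massey products are
   considered for k >= 2, those with k = 2 being products up to sign. *)
Definition massey_degree p (i j : nat) : nat :=
  (\sum_(i <= l < j.+1) p l - (j - i))%N.

Definition massey_sum p a (i j : nat) : C :=
  \sum_(i <= r < j) (-1) ^+ (massey_degree p i r).+1 * (a i r * a r.+1 j).

Definition defining_system (k : nat) w p a : Prop :=
  (forall i, (1 <= i <= k)%N -> represents (a i i) (w i)) /\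
  (forall i j, (1 <= i)%N -> (i <= j)%N -> (j <= k)%N -> (i, j) <> (1%N, k) ->
     degree (massey_degree p i j) (a i j) /\ dga_d (a i j) = massey_sum p a i j).

Definition massey_product (k : nat) w p (x : H) : Prop :=
  exists a, defining_system k w p a /\ represents (massey_sum p a 1%N k) x.

(* A class 0 has several degrees, hence the quantification over p. *)
Definition massey_vanishes (k : nat) w : Prop :=
  forall p, (forall i, (1 <= i <= k)%N -> (0 < p i)%N /\ has_degree (p i) (w i)) ->
  (exists x, massey_product k w p x) -> massey_product k w p 0.

End Massey.

Section Nill.
Variable C : dga.

Definition products_vanish (k : nat) : Prop :=
  forall a : 'I_k -> cohomology C,
    (forall i, in_plus (a i)) -> \prod_(i < k) a i = 0.

Definition is_nill (k : nat) : Prop :=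
  products_vanish k /\ forall l, products_vanish l -> (k <= l)%N.

End Nill.

(* Simplicial complexes on the vertex set 'I_n, without ghost vertices. *)
Record simplicial_complex (n : nat) := Complex {
  faces : {set {set 'I_n}};
  faces0 : set0 \in faces;
  facesS : forall s t : {set 'I_n}, s \subset t -> t \in faces -> s \in faces;
  faces1 : forall i, [set i] \in faces
}.

Section GraphComplex.
Variables (n : nat) (e : rel 'I_n).

Definition graph_faces : {set {set 'I_n}} :=
  [set s : {set 'I_n} |
    (#|s| <= 1)%N || [exists i, exists j, e i j && (s == [set i; j])]].

Lemma graph_faces0 : set0 \in graph_faces.
Proof. by rewrite inE cards0. Qed.

Lemma graph_facesS (s t : {set 'I_n}) :
  s \subset t -> t \in graph_faces -> s \in graph_faces.
Proof.
rewrite !inE => st /orP[t1|/existsP[i /existsP[j /andP[eij /eqP te]]]].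
  by rewrite (leq_trans (subset_leq_card st) t1).
have [s1|s2] := leqP #|s| 1; rewrite //=.
apply/existsP; exists i; apply/existsP; exists j; rewrite eij -te /=.
rewrite eqEcard st te cards2 /=; apply: leq_trans s2.
by case: (_ != _).
Qed.

Lemma graph_faces1 (i : 'I_n) : [set i] \in graph_faces.
Proof. by rewrite inE cards1. Qed.

Definition graph_complex : simplicial_complex n :=
  Complex graph_faces0 graph_facesS graph_faces1.

End GraphComplex.

Module StanleyReisner.
Import mpoly.

Section StanleyReisner.
Context {n : nat} (K : simplicial_complex n).
Local Notation Zv := {mpoly int[n]}.

(* The ideal generated by the monomials of the non-faces of K. *)
Definition ideal : {pred Zv} :=
  [pred f : Zv | `[< exists c : {set 'I_n} -> Zv,
     f = \sum_(s | s \notin faces K) c s * \prod_(i in s) 'X_i >]].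

Lemma idealP f : reflect
  (exists c : {set 'I_n} -> Zv,
     f = \sum_(s | s \notin faces K) c s * \prod_(i in s) 'X_i)
  (f \in ideal).
Proof. exact: asboolP. Qed.

Lemma ideal_closed : idealr_closed ideal.
Proof.
split=> [||a u v /idealP[c ->] /idealP[c' ->]].
- by apply/idealP; exists (fun=> 0); rewrite big1 // => s _; rewrite mul0r.
- apply/negP => /idealP[c] /(congr1 (meval (fun=> 0))).
  rewrite meval1 raddf_sum big1 => [/eqP|s sK /=]; first by rewrite oner_eq0.
  rewrite mevalM rmorph_prod /=; have [s0|[i si]] := set_0Vmem s.
    by rewrite s0 faces0 in sK.
  by rewrite (bigD1 i) //= mevalXU mul0r mulr0.
- apply/idealP; exists (fun s => a * c s + c' s).
  rewrite mulr_sumr -big_split; apply: eq_bigr => s _.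
  by rewrite mulrDl mulrA.
Qed.

HB.instance Definition _ := isIdealr.Build Zv ideal ideal_closed.

Definition ring := {ideal_quot ideal}.
HB.instance Definition _ := GRing.ComNzRing.on ring.

Definition v (i : 'I_n) : ring := \pi_ring 'X_i.

Definition mnm_supp (m : 'X_{1..n}) : {set 'I_n} := [set i | m i != 0%N].

Lemma prodX (s : {set 'I_n}) :
  \prod_(i in s) 'X_i = 'X_[[multinom (i \in s : nat) | i < n]] :> Zv.
Proof.
rewrite mprodXE; congr 'X_[_]; apply/mnmP => i.
rewrite mnm_sumE mnmE; case: (boolP (i \in s)) => si.
  rewrite (bigD1 i) //= mnm1E eqxx big1 // => j /andP[_ /negPf ji].
  by rewrite mnm1E ji.
rewrite big1 // => j js; rewrite mnm1E; case: eqP => // ji.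
by rewrite -ji js in si.
Qed.

Lemma ideal_msupp f :
  (f \in ideal) <-> {in msupp f, forall m, mnm_supp m \notin faces K}.
Proof.
split=> [/idealP[c ->] m|fK]; last first.
  rewrite [f]mpolyE big_seq; apply: rpred_sum => m mf.
  rewrite -mul_mpolyC; apply: idealMr.
  pose s := mnm_supp m; have sK := fK _ mf.
  have -> : 'X_[m] = 'X_[m - [multinom (i \in s : nat) | i < n]] *
      \prod_(i in s) 'X_i :> Zv.
    rewrite prodX -mpolyXD; congr 'X_[_]; apply/mnmP => i.
    rewrite mnmDE mnmBE mnmE inE subnK //; case: (m i) => //.
  apply: idealMr; apply/idealP; exists (fun t => (t == s)%:R).
  rewrite [RHS](bigD1 s) //= eqxx mulr1n mul1r [X in _ + X]big1 ?addr0 // => t /andP[_ /negPf ->].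
  by rewrite mul0r.
rewrite mcoeff_msupp raddf_sum /= => nz.
have [s sK nzs] : exists2 s, s \notin faces K &
    (c s * \prod_(i in s) 'X_i)@_m != 0.
  apply/exists_inP; apply: contraNT nz => /exists_inPn h.
  by rewrite big1 // => s sK; apply/eqP; move: (h s sK); rewrite negbK.
move: nzs; rewrite -mcoeff_msupp prodX => /msuppM_le /allpairsP[[m1 m2] /= [_ h ->]].
move: h; rewrite msuppX inE => /eqP ->.
apply: contraNN sK; apply: facesS; apply/subsetP => i si.
by rewrite inE mnmDE mnmE si addnS.
Qed.

(* The classes in Z[K] of the polynomials all of whose monomials m, with
   deg v_i = 2, satisfy c + deg m = k. *)
Definition homogeneous (c k : nat) (a : ring) : Prop :=
  exists f : Zv, a = \pi_ring f /\
    {in msupp f, forall m, (c + 2 * mdeg m = k)%N}.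

Lemma homogeneous0 c k : homogeneous c k 0.
Proof.
exists 0; split; first by rewrite raddf0.
by move=> m; rewrite msupp0.
Qed.

Lemma homogeneousB c k a b :
  homogeneous c k a -> homogeneous c k b -> homogeneous c k (a - b).
Proof.
move=> [f [-> hf]] [g [-> hg]]; exists (f - g); split; first by rewrite raddfB.
by move=> m /msuppB_le; rewrite mem_cat => /orP[/hf|/hg].
Qed.

Lemma homogeneousN c k a : homogeneous c k a -> homogeneous c k (- a).
Proof. by rewrite -sub0r; apply: homogeneousB; exact: homogeneous0. Qed.

Lemma homogeneousD c k a b :
  homogeneous c k a -> homogeneous c k b -> homogeneous c k (a + b).
Proof.
by move=> ha hb; rewrite -[b]opprK; apply: homogeneousB => //; exact: homogeneousN.
Qed.

Lemma homogeneous_sum I (r : seq I) (P : pred I) F c k :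
  (forall i, P i -> homogeneous c k (F i)) ->
  homogeneous c k (\sum_(i <- r | P i) F i).
Proof.
by apply: big_ind; [exact: homogeneous0 | exact: homogeneousD].
Qed.

Lemma homogeneous_sign c k (e : nat) a :
  homogeneous c k a -> homogeneous c k ((-1) ^+ e * a).
Proof.
rewrite -signr_odd mulr_sign; case: odd => //; exact: homogeneousN.
Qed.

Lemma homogeneousM c c' k k' a b : homogeneous c k a -> homogeneous c' k' b ->
  homogeneous (c + c') (k + k') (a * b).
Proof.
move=> [f [-> hf]] [g [-> hg]]; exists (f * g); split; first by rewrite rmorphM.
move=> m /msuppM_le /allpairsP[[m1 m2] /= [/hf <- /hg <- ->]].
by rewrite mdegD mulnDr addnACA.
Qed.

Lemma homogeneous_v i : homogeneous 0 2 (v i).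
Proof.
by exists 'X_i; split=> // m; rewrite msuppX inE => /eqP ->; rewrite mdeg1.
Qed.

Lemma homogeneous_total c (a : ring) : exists N, forall M, (N <= M)%N ->
  exists y : nat -> ring,
    [/\ forall k, homogeneous c k (y k), a = \sum_(k < M) y k
       & y = fun k => \pi_ring (\sum_(m <- msupp (repr a) |
           (c + 2 * mdeg m)%N == k) (repr a)@_m *: 'X_[m])].
Proof.
exists (c + 2 * msize (repr a))%N => M NM; eexists; split; last by [].
- move=> k; eexists; split; first by [].
  move=> m; rewrite mcoeff_msupp raddf_sum /= => nz; apply/eqP.
  apply: contraNT nz => nk; rewrite big1 // => m' /eqP m'k.
  rewrite mcoeffZ mcoeffX; case: eqP => [mm'|]; last by rewrite mulr0.
  by rewrite -mm' m'k eqxx in nk.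
- rewrite -raddf_sum (exchange_big_dep predT) //= -[LHS]reprK.
  congr \pi; rewrite {1}[repr a]mpolyE; apply: eq_big_seq => m mf.
  have lt : (c + 2 * mdeg m < M)%N.
    apply: leq_trans NM; rewrite ltn_add2l ltn_pmul2l //.
    exact: msize_mdeg_lt.
  by rewrite (big_pred1 (Ordinal lt)) // => i; rewrite /= -val_eqE eq_sym.
Qed.

Lemma homogeneous_free c N (y : nat -> ring) :
  (forall k, homogeneous c k (y k)) -> \sum_(k < N) y k = 0 ->
  forall k, (k < N)%N -> y k = 0.
Proof.
move=> /choice[f hf] y0 k kN.
have yE i : y i = \pi_ring (f i) by case: (hf i).
have inI g : (\pi_ring g = 0) <-> (g \in ideal).
  rewrite -[g in g \in _]subr0 Quotient.idealrBE -/ring.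
  by rewrite raddf0; split=> /eqP.
rewrite yE; apply/inI/ideal_msupp => m mk.
have /inI/ideal_msupp : \pi_ring (\sum_(i < N) f i) = 0.
  by rewrite raddf_sum -[RHS]y0; apply: eq_bigr => i _; rewrite /= yE.
apply; rewrite mcoeff_msupp raddf_sum /= (bigD1 (Ordinal kN)) //=.
rewrite big1 ?addr0 -?mcoeff_msupp // => i ik.
apply/eqP; rewrite mcoeff_eq0; apply: contraNN ik => mi.
have [_ /(_ _ mi)] := hf i; have [_ /(_ _ mk) ->] := hf k.
by move=> e; rewrite -val_eqE /= -e.
Qed.

Local Notation E := (exterior n ring).

(* The total degree, with deg u_i = 1 and deg v_i = 2. *)
Definition koszul_degree (k : nat) (x : E) : Prop :=
  forall J : {set 'I_n}, homogeneous #|J| k (x J).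

Lemma koszul_degree0 k : koszul_degree k 0.
Proof. by move=> J; rewrite ffunE; exact: homogeneous0. Qed.

Lemma koszul_degreeB k x y :
  koszul_degree k x -> koszul_degree k y -> koszul_degree k (x - y).
Proof. by move=> hx hy J; rewrite !ffunE; exact: homogeneousB. Qed.

Lemma koszul_degree1 : koszul_degree 0%N 1.
Proof.
move=> J; rewrite ffunE; case: eqP => [->|_]; last exact: homogeneous0.
exists 1; split; first by rewrite mulr1n rmorph1.
by move=> m; rewrite msupp1 inE => /eqP ->; rewrite mdeg0 cards0.
Qed.

Lemma koszul_degreeM k l x y : koszul_degree k x -> koszul_degree l y ->
  koszul_degree (k + l) (x * y).
Proof.
move=> hx hy J; rewrite extM; apply: homogeneous_sum => I IJ.
apply: homogeneous_sign; have -> : #|J| = (#|I| + #|J :\: I|)%N.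
  by rewrite -{1}(setIidPr IJ) cardsID.
exact: homogeneousM.
Qed.

Lemma koszul_degree_total x : exists N (y : nat -> E),
  (forall k, koszul_degree k (y k)) /\ x = \sum_(k < N) y k.
Proof.
have /choice[N hN] := fun J : {set 'I_n} => homogeneous_total #|J| (x J).
pose M := (\max_J N J)%N.
have /choice[y hy] : forall J : {set 'I_n}, exists y : nat -> ring,
    (forall k, homogeneous #|J| k (y k)) /\ x J = \sum_(k < M) y k.
  by move=> J; have [y [? ? _]] := hN J M (leq_bigmax J); exists y.
exists M, (fun k => [ffun J => y J k] : E); split=> [k J|].
  by rewrite ffunE; case: (hy J).
apply/ffunP => J; rewrite sum_ffunE; have [_ ->] := hy J.
by apply: eq_bigr => k _; rewrite ffunE.
Qed.

Lemma koszul_degree_free N (y : nat -> E) :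
  (forall k, koszul_degree k (y k)) -> \sum_(k < N) y k = 0 ->
  forall k, (k < N)%N -> y k = 0.
Proof.
move=> hy y0 k kN; apply/ffunP => J; rewrite [RHS]ffunE.
apply: (@homogeneous_free #|J| N (fun k => y k J)) => // [i|].
  exact: hy.
by have /ffunP/(_ J) := y0; rewrite sum_ffunE [RHS]ffunE.
Qed.

Lemma koszul_degree_d k x :
  koszul_degree k x -> koszul_degree k.+1 (koszul_d v x).
Proof.
move=> hx J; rewrite ffunE; apply: homogeneous_sum => j jJ.
apply: homogeneous_sign.
have [f [-> hf]] := hx (j |: J); exists ('X_j * f); split.
  by rewrite rmorphM.
move=> m /msuppM_le /allpairsP[[m1 m2] /= [+ /hf + ->]].
rewrite msuppX inE => /eqP -> <-; rewrite mdegD mdeg1 cardsU1 jJ.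
by rewrite mulnDr addnCA -addnA.
Qed.

Lemma koszul_degree_leibniz k x y : koszul_degree k x ->
  koszul_d v (x * y) = koszul_d v x * y + (-1) ^+ k * (x * koszul_d v y).
Proof.
move=> hx; rewrite koszul_leibniz mulrA; congr (_ + _ * _).
apply/ffunP => J; rewrite ffunE -[in LHS]signr_odd -[in RHS]signr_odd.
rewrite !mulr_sign; have [f [xJ hf]] := hx J.
case: (altP (f =P 0)) => [f0|]; last first.
  rewrite -msupp_eq0 -size_eq0 -lt0n => /mem_nth -/(_ 0%MM)/hf <-.
  rewrite oddD mul2n odd_double addbF.
  by case: odd => //; rewrite ffunE.
have xJ0 : x J = 0 by rewrite xJ f0 raddf0.
by case: odd; case: odd; rewrite ?ffunE xJ0 ?oppr0.
Qed.

Definition koszul_dga : dga :=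
  @DGA E koszul_degree (koszul_d v) koszul_degree0 koszul_degreeB
    koszul_degree1 koszul_degreeM koszul_degree_total koszul_degree_free
    (koszul_dB v) koszul_degree_d (koszul_dd v) koszul_degree_leibniz.

End StanleyReisner.
End StanleyReisner.

Notation koszul_dga := StanleyReisner.koszul_dga.

(* Tor_(Z[v_1, .., v_n])(Z[K], Z), as the cohomology algebra of the Koszul DGA
   Lambda[u_1, .., u_n] (x) Z[K], d u_i = v_i. *)
Definition Tor {n : nat} (K : simplicial_complex n) := cohomology (koszul_dga K).
HB.instance Definition _ (n : nat) (K : simplicial_complex n) :=
  GRing.PzRing.on (Tor K).

(* Massey products are indexed from 1, so the parities of i and j are literal. *)
Definition annihilating {n : nat} (K : simplicial_complex n) (m : nat) : Prop :=
  (exists k, is_nill (koszul_dga K) k /\ (k <= m.+1)%N) /\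
  (forall k (w : nat -> Tor K), (2 <= k)%N ->
     (forall i, (1 <= i <= k)%N -> in_plus (w i)) ->
     (exists i j mi mj,
        [/\ (1 <= i <= k)%N && odd i, (1 <= j <= k)%N && ~~ odd j,
            (0 < mi)%N /\ is_product mi (w i),
            (0 < mj)%N /\ is_product mj (w j) & (m < mi + mj)%N]) ->
     massey_vanishes k w).

From mathcomp Require Import all_classical all_reals all_analysis.
Import numFieldNormedType.Exports.

Local Open Scope classical_set_scope.
Local Open Scope ring_scope.

Section Category.
Variables (R : realType) (X : topologicalType).

(* The inclusion of U into X is homotopic to a constant map; H is only relevant
   on U `*` `[0, 1]. *)
Definition nullhomotopic_in (U : set X) : Prop :=
  exists (H : X * R -> X) (c : X),
    [/\ {within U `*` `[0, 1], continuous H},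
        forall x, U x -> H (x, 0) = x
      & forall x, U x -> H (x, 1) = c].

Definition categorical_cover (k : nat) : Prop :=
  exists U : 'I_k.+1 -> set X,
    [/\ forall i, open (U i), forall i, nullhomotopic_in (U i)
      & \bigcup_i U i = setT].

Definition is_cat (k : nat) : Prop :=
  categorical_cover k /\ forall l, categorical_cover l -> (k <= l)%N.

End Category.

Section MomentAngle.
Variables (R : realType) (n : nat) (K : simplicial_complex n).

Definition unit_disk : set (R * R) := [set z | z.1 ^+ 2 + z.2 ^+ 2 <= 1].
Definition unit_circle : set (R * R) := [set z | z.1 ^+ 2 + z.2 ^+ 2 = 1].

Definition moment_angle_set : set {ptws 'I_n -> (R * R)%type} :=
  \bigcup_(s in [set s : {set 'I_n} | s \in faces K])
    [set z | forall i, (if i \in s then unit_disk else unit_circle) (z i)].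

Definition moment_angle : topologicalType := set_type moment_angle_set.

End MomentAngle.

(* Main.v *)
From HB Require Import structures.
Require Import Defs.
From mathcomp Require Import all_boot all_order all_algebra.
From mathcomp Require Import generic_quotient ring_quotient boolp.
From mathcomp Require Import zify.
From mathcomp Require mpoly.

Set Implicit Arguments.
Unset Strict Implicit.
Unset Printing Implicit Defensive.

Import Order.TTheory GRing.Theory Num.Theory.

Local Open Scope ring_scope.
Local Open Scope quotient_scope.

(** Write [d] for the differential of the Koszul algebra of the graph, whose
    monomials are [u_J v^m] with the support of [m] a face.

    Algebra.  Filter the Koszul algebra by the degree in the [v_i].  This
    filtration is multiplicative, [d] raises it by one, and two more facts
    about it decide everything.
    - A homogeneous element of positive degree whose differential lies in
      filtration 2 lies itself in filtration 1, because [d] is injective on the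
      positive part of [Lambda[u]] ([koszul_weight_pos]).  So classes of positive degree
      have representatives in filtration 1, and products of [m] of them have
      representatives in filtration [m].
    - A cocycle in filtration 3 is the differential of an element of
      filtration 2 ([koszul_weight_exact]).  Indeed a face of a graph has at
      most two vertices, so a [v]-monomial of degree 3 repeats a variable, and
      the part of the Koszul complex whose multidegree is at least 2 in some
      variable [i] is contracted by [v_i |-> u_i].
    Products of three classes of positive degree have representatives in
    filtration 3, so they vanish ([triple_products_vanish]).  For Massey
    products, the first fact puts the entries of every defining system into
    filtration 1 ([defining_system_weight]).  If [w_t] is decomposable,
    replace its entry by a representative in filtration 2, keep the entries
    [a i j] unless [i <= t <= j], and rebuild the others in filtration 2
    by induction on [j - i]: the sum of products that such an entry has to
    bound is a cocycle in filtration 3, so the second fact supplies the entry.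
    The value of the new system lies in filtration 3 too, so its class is 0
    ([massey_vanishes_of_weight]).  When [m_i + m_j > 2], one of the classes
    [w_i] and [w_j] is such a [w_t].

    Topology.  For a face [S], let [dominated S] be the set of the points [z]
    with [|z_i| < |z_l|] for [i] in [S] and [l] outside, and [z_l <> 0] for [l]
    outside [S].  A point lies in [dominated S] for its zero set [S], and for
    distinct [S] of the same size these open sets are disjoint.  Each of them
    contracts to the point [(1, .., 1)]: slide the coordinates in [S] to 1 while
    pushing the others radially to the circle, which happens within the
    polydisk of one face containing [S], and then slide the remaining
    coordinates to 1 one after the other, each across the disk of its vertex.
    The unions over the faces with 0, 1 and 2 vertices form a categorical cover
    ([categorical_cover_faces]). *)

(** * Cocycle representatives of cohomology classes *)

Section Representatives.
Context {C : dga}.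
Local Notation d := (@dga_d C).
Implicit Types (x y c : C) (w : cohomology C).

Lemma represents_d0 x w : represents x w -> d x = 0.
Proof. by case=> z [<- _]; exact/cocycleP/valP. Qed.

Lemma pi_cohomology_eq (y z : cocycles C) :
  \pi_(cohomology C) y = \pi_(cohomology C) z <-> exists c, val y - val z = d c.
Proof.
split=> [/eqP|[c yz]]; last apply/eqP; rewrite -[_ == _]Quotient.idealrBE.
  by move/coboundaryP => [c]; rewrite rmorphB; exists c.
by apply/coboundaryP; exists c; rewrite rmorphB.
Qed.

Lemma represents_inj x y w : represents x w -> represents y w ->
  exists c, x - y = d c.
Proof.
by case=> z [<- zw] [z' [<- zw']]; apply/pi_cohomology_eq; rewrite zw.
Qed.

Lemma represents_shift x c w : represents x w -> represents (x - d c) w.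
Proof.
case=> z [<- <-]; have dz : dga_d (val z - d c) = 0.
  by rewrite dga_dB dga_dd subr0; exact/cocycleP/valP.
have zc : val z - d c \in @cocycle C by exact/cocycleP.
exists (Cocycle zc); split=> //; apply/pi_cohomology_eq; exists (- c).
by rewrite /= addrAC subrr add0r raddfN.
Qed.

Lemma representsM x y w w' : represents x w -> represents y w' ->
  represents (x * y) (w * w').
Proof.
case=> z [<- <-] [z' [<- <-]]; exists (z * z'); split; first exact: rmorphM.
by rewrite -pi_cohomologyM.
Qed.

Lemma represents0 : represents (0 : C) 0.
Proof. by exists 0; split; [exact: rmorph0 | exact: raddf0]. Qed.

Lemma represents1 : represents (1 : C) 1.
Proof. by exists 1. Qed.

Lemma representsD x y w w' : represents x w -> represents y w' ->
  represents (x + y) (w + w').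
Proof.
case=> z [<- <-] [z' [<- <-]]; exists (z + z'); split; first exact: rmorphD.
exact: raddfD.
Qed.

Lemma represents_boundary c : represents (d c) 0.
Proof.
have -> : d c = 0 - d (- c); last exact/represents_shift/represents0.
by rewrite raddfN sub0r opprK.
Qed.

Lemma represents_boundary_eq0 c w : represents (d c) w -> w = 0.
Proof.
case=> z [zc <-]; rewrite -[RHS](raddf0 \pi_(cohomology C)).
by apply/pi_cohomology_eq; exists c; rewrite rmorph0 subr0.
Qed.

End Representatives.

(** * Massey sums *)

Section MasseySums.
Context {C : dga}.
Local Notation d := (@dga_d C).
Implicit Types (x y c : C) (a : nat -> nat -> C) (p : nat -> nat).

Lemma degreeN k x : degree k x -> degree k (- x).
Proof. by rewrite -sub0r; apply: degreeB; exact: degree0. Qed.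

Lemma degreeD k x y : degree k x -> degree k y -> degree k (x + y).
Proof. by move=> kx ky; rewrite -[y]opprK; apply/degreeB/degreeN. Qed.

Lemma degree_sum k (I : eqType) (r : seq I) (F : I -> C) :
  (forall i, i \in r -> degree k (F i)) -> degree k (\sum_(i <- r) F i).
Proof.
move=> kF; rewrite big_seq; elim/big_ind: _ => //; first exact: degree0.
by move=> x y; apply: degreeD.
Qed.

Lemma degree_sign k e x : degree k x -> degree k ((-1) ^+ e * x).
Proof. by rewrite -signr_odd mulr_sign; case: odd => // /degreeN. Qed.

Lemma d_sign e x : d ((-1) ^+ e * x) = (-1) ^+ e * d x.
Proof. by rewrite -signr_odd !mulr_sign; case: odd; rewrite ?raddfN. Qed.

Lemma massey_degree_sum p i j : (forall l, (i <= l <= j)%N -> (0 < p l)%N) ->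
  (i <= j)%N -> (massey_degree p i j + (j - i) = \sum_(i <= l < j.+1) p l)%N
  /\ (0 < massey_degree p i j)%N.
Proof.
move=> p0 ij; suff lt : (j - i < \sum_(i <= l < j.+1) p l)%N.
  by rewrite /massey_degree subnK ?subn_gt0 // ltnW.
rewrite -subSn // -[leqLHS]muln1 -sum_nat_const_nat big_nat [leqRHS]big_nat.
exact: leq_sum.
Qed.

(** Positive degrees make the truncated subtraction in [massey_degree] exact.  The
    successor is the degree of the differential: the product of the entries over
    the two parts has the degree of the differential of the entry over [i], [j]. *)
Lemma massey_degreeD p i r j : (forall l, (i <= l <= j)%N -> (0 < p l)%N) ->
  (i <= r < j)%N ->
  (massey_degree p i r + massey_degree p r.+1 j = (massey_degree p i j).+1)%N.
Proof.
move=> p0 /andP[ir rj].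
have [] := @massey_degree_sum p i j p0 (ltnW (leq_ltn_trans ir rj)).
have [||] := @massey_degree_sum p i r; [by move=> l lr; apply: p0; lia | done|].
have [||] := @massey_degree_sum p r.+1 j; [by move=> l lr; apply: p0; lia | done|].
rewrite (@big_cat_nat _ _ _ r.+1 i j.+1) /=; lia.
Qed.

(** The terms [a i q * a q.+1 r * a r.+1 j] arise twice from the Leibniz rule,
    once by expanding [a i r] and once by expanding [a q.+1 j], with opposite
    signs. *)
Lemma massey_sum_cocycle p a i j :
  (forall l, (i <= l <= j)%N -> (0 < p l)%N) ->
  (forall i' j', (i <= i')%N -> (i' <= j')%N -> (j' <= j)%N ->
     (j' - i' < j - i)%N -> degree (massey_degree p i' j') (a i' j') /\
     d (a i' j') = massey_sum p a i' j') ->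
  degree (massey_degree p i j).+1 (massey_sum p a i j) /\
  d (massey_sum p a i j) = 0.
Proof.
move=> p0 ha; split.
  apply: degree_sum => r; rewrite mem_index_iota => ir; apply: degree_sign.
  rewrite -(massey_degreeD p0 ir); case/andP: ir => ir rj.
  have [dg1 _] := ha i r (leqnn _) ir (ltnW rj) ltac:(lia).
  have [dg2 _] := ha r.+1 j ltac:(lia) ltac:(lia) (leqnn _) ltac:(lia).
  exact: degreeM.
pose s i r : C := (-1) ^+ (massey_degree p i r).+1.
have sC i' r x : x * s i' r = s i' r * x.
  by rewrite /s -signr_odd mulr_sign; case: odd; rewrite ?mulrN ?mulr1.
pose F q r := s i r * s i q * (a i q * a q.+1 r * a r.+1 j).
pose G q r := s i q * (-1) ^+ massey_degree p i q * s q.+1 r *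
  (a i q * a q.+1 r * a r.+1 j).
transitivity (\sum_(i <= r < j) \sum_(i <= q < r) F q r +
   \sum_(i <= q < j) \sum_(q.+1 <= r < j) G q r).
  rewrite raddf_sum -big_split /= !big_nat; apply: eq_bigr => r /andP[ir rj].
  have [dg1 d1] := ha i r (leqnn _) ir (ltnW rj) ltac:(lia).
  have [dg2 d2] := ha r.+1 j ltac:(lia) ltac:(lia) (leqnn _) ltac:(lia).
  rewrite d_sign (leibniz _ dg1) d1 d2 mulrDr -/(s i r); congr (_ + _).
    rewrite mulr_suml mulr_sumr; apply: eq_bigr => q _.
    by rewrite /F -!mulrA.
  rewrite !mulr_sumr; apply: eq_bigr => q _; rewrite /G -/(s r.+1 q).
  by rewrite -!mulrA; do 2!congr (_ * _); rewrite !mulrA sC.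
have -> : \sum_(i <= q < j) \sum_(q.+1 <= r < j) G q r =
    \sum_(i <= r < j) \sum_(i <= q < r) G q r.
  transitivity (\sum_(i <= q < j) \sum_(i <= r < j | (q < r)%N) G q r).
    rewrite big_nat [RHS]big_nat; apply: eq_bigr => q /andP[iq _].
    by rewrite (big_nat_widenl _ i) // ltnW.
  rewrite (exchange_big_dep_nat predT) //= big_nat [RHS]big_nat.
  by apply: eq_bigr => r /andP[_ rj]; rewrite [RHS](@big_nat_widen _ _ _ i r j) // ltnW.
rewrite -big_split /= big_nat big1 // => r /andP[ir rj].
rewrite -big_split /= big_nat big1 // => q /andP[iq qr].
rewrite /F /G -mulrDl; set S := _ + _; suff -> : S = 0 by rewrite mul0r.
have D : (massey_degree p i q + massey_degree p q.+1 r = (massey_degree p i r).+1)%N.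
  by apply: massey_degreeD => [l lr|]; [apply: p0|]; lia.
rewrite /S /s -!exprD -[X in X + _]signr_odd -[X in _ + X]signr_odd.
have -> : odd ((massey_degree p i q).+1 + massey_degree p i q +
    (massey_degree p q.+1 r).+1) =
    ~~ odd ((massey_degree p i r).+1 + (massey_degree p i q).+1) by lia.
by case: odd; rewrite /= ?subrr ?addNr.
Qed.
End MasseySums.

(** * Filtrations that force products to vanish *)

Section WeightFiltration.
Context {C : dga}.
Local Notation d := (@dga_d C).
Local Notation H := (cohomology C).
Implicit Types (x y z c : C) (a b : nat -> nat -> C) (p : nat -> nat).

(** What the vanishing arguments use of the filtration by [v]-degree.  The last
    two fields say that cohomology of positive degree starts in filtration 1
    and that filtration 3 is acyclic. *)
Record weight_filtration (W : nat -> C -> Prop) := WeightFiltration {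
  weight0 : forall s, W s 0;
  weightN : forall s x, W s x -> W s (- x);
  weightD : forall s x y, W s x -> W s y -> W s (x + y);
  weight_le : forall s t x, (s <= t)%N -> W t x -> W s x;
  weight_top : forall x, W 0%N x;
  weightM : forall s t x y, W s x -> W t y -> W (s + t)%N (x * y);
  weight_split : forall s x, W s x -> exists N (y : nat -> C),
    (forall k, degree k (y k) /\ W s (y k)) /\ x = \sum_(k < N) y k;
  weight_pos : forall k x, degree k.+1 x -> W 2%N (d x) -> W 1%N x;
  weight_exact : forall z, W 3%N z -> d z = 0 -> exists c,
    [/\ W 2%N c, d c = z & forall k, degree k.+1 z -> degree k c]
}.

Variables (W : nat -> C -> Prop) (WF : weight_filtration W).

Lemma weight_sum s (I : eqType) (r : seq I) (F : I -> C) :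
  (forall i, i \in r -> W s (F i)) -> W s (\sum_(i <- r) F i).
Proof.
move=> kF; rewrite big_seq; elim/big_ind: _ => //; first exact: (weight0 WF).
exact: (weightD WF).
Qed.

Lemma weight_sign s e x : W s x -> W s ((-1) ^+ e * x).
Proof.
by rewrite -signr_odd mulr_sign; case: odd => // /(weightN WF).
Qed.

Lemma in_plus_weight (h : H) : in_plus h -> exists2 x, W 1%N x & represents x h.
Proof.
case=> N [y [yP ->]]; elim/big_rec: _ => [|i h' _ [x Wx xh]].
  by exists 0; [exact: (weight0 WF)|exact: represents0].
have [z [dz zy]] := yP i; exists (z + x); last exact: representsD.
apply: (weightD WF) => //; apply: (weight_pos WF dz).
by rewrite (represents_d0 zy); exact: (weight0 WF).
Qed.

Lemma product_weight m (h : H) :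
  is_product m h -> exists2 x, W m x & represents x h.
Proof.
case=> a [aP ->]; elim: m a aP => [|m IHm] a aP.
  by rewrite big_ord0; exists 1; [exact: (weight_top WF)|exact: represents1].
have [x Wx xh] := in_plus_weight (aP ord0).
have [y Wy yh] := IHm _ (fun i => aP (lift ord0 i)).
rewrite big_ord_recl; exists (x * y); last exact: representsM.
exact: (weightM WF Wx Wy).
Qed.

Lemma triple_products_vanish : products_vanish C 3.
Proof.
move=> a aP; have [|x Wx xh] := @product_weight 3 (\prod_(i < 3) a i).
  by exists a.
have [c [_ dc _]] := weight_exact WF Wx (represents_d0 xh).
by apply: (@represents_boundary_eq0 _ c); rewrite dc.
Qed.

(** A representative in filtration [s] need not be homogeneous.  It differs by a
    boundary from a homogeneous one, and so does its component of degree [k]: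
    compare the components of degree [k] in that relation. *)
Lemma homogeneous_representative s k (h : H) x : has_degree k h -> W s x ->
  represents x h -> exists y, [/\ W s y, degree k y & represents y h].
Proof.
move=> [y [ky yh]] Wx xh; have [N [X [XP xX]]] := weight_split WF Wx.
have [z xyz] := represents_inj xh yh; have [M [Z [ZP zZ]]] := degree_total z.
pose Z' i := if i is i'.+1 then (if (i' < M)%N then Z i' else 0) else 0.
(* [Z' i] is the component of degree [i.-1] of [z], so [dg i] is the component
   of degree [i] of [x - y - d z]. *)
pose dg i : C := (if (i < N)%N then X i else 0) -
   (if i == k then y else 0) - d (Z' i).
have dgP i : degree i (dg i).
  apply: degreeB; first apply: degreeB.
  - by case: ifP => _; [case: (XP i) | exact: degree0].
  - by case: eqP => [->|_]; [exact: ky | exact: degree0].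
  - case: i => [|i] /=; first by rewrite raddf0; exact: degree0.
    by case: ifP => _; [exact: degree_d | rewrite raddf0; exact: degree0].
pose L := (maxn N M + k).+2.
have dg0 : \sum_(i < L) dg i = 0.
  rewrite !sumrB.
  have -> : \sum_(i < L) (if (i < N)%N then X i else 0) = x.
    by rewrite xX -big_mkcond -big_ord_widen // /L; lia.
  have -> : \sum_(i < L) (if i == k :> nat then y else 0) = y.
    rewrite -big_mkcond (big_pred1 (inord k)) // => i.
    by rewrite [RHS]/= -(inj_eq val_inj) /= inordK // /L; lia.
  have -> : \sum_(i < L) d (Z' i) = d z.
    rewrite big_ord_recl raddf0 add0r zZ -raddf_sum /=; congr d.
    by rewrite -big_mkcond -big_ord_widen // /L; lia.
  by rewrite xyz subrr.
have := degree_free dgP dg0 (k := k) _; rewrite /dg eqxx => /(_ ltac:(rewrite /L; lia)) E.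
set u := (if (k < N)%N then X k else 0) in E.
have uy : u = y - d (- Z' k).
  by move/eqP: E; rewrite subr_eq0 raddfN opprK subr_eq addrC => /eqP.
exists u; split; last by rewrite uy; exact: represents_shift.
- by rewrite /u; case: ifP => _; [case: (XP k) | exact: (weight0 WF)].
- by rewrite /u; case: ifP => _; [case: (XP k) | exact: degree0].
Qed.

(** By induction on [j - i], the differential of [a i j] is a sum of products of
    elements of filtration 1, and the degree of [a i j] is positive. *)
Lemma defining_system_weight k w p a :
  (forall l, (1 <= l <= k)%N -> (0 < p l)%N) -> defining_system k w p a ->
  forall i j, (1 <= i)%N -> (i <= j)%N -> (j <= k)%N -> (i, j) <> (1%N, k) ->
  W 1%N (a i j).
Proof.
move=> p0 [_ aP] i j; have [m] := ubnP (j - i); elim: m i j => // m IHm i j.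
rewrite ltnS => ijm i1 ij jk ijk; have [da ea] := aP i j i1 ij jk ijk.
have [|_] := @massey_degree_sum p i j _ ij; first by move=> l lr; apply: p0; lia.
case: massey_degree da => // dg da _; apply: (weight_pos WF da); rewrite ea.
apply: weight_sum => r; rewrite mem_index_iota => /andP[ir rj].
apply: weight_sign; apply: (weightM WF (s := 1) (t := 1)); apply: IHm;
  by [lia | case; lia].
Qed.

(** The entries over intervals containing [t] are rebuilt inside filtration 2;
    the products in their differentials then lie in filtration 3, which is
    acyclic, so no obstruction arises. *)
Lemma massey_vanishes_of_weight k (w : nat -> H) t x : (2 <= k)%N ->
  (1 <= t <= k)%N -> W 2%N x -> represents x (w t) -> massey_vanishes k w.
Proof.
move=> k2 tk Wx xw p pP [_ [a [aD _]]].
have p0 l : (1 <= l <= k)%N -> (0 < p l)%N by case/pP.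
have Wa := defining_system_weight p0 aD; case: aD => aw aP.
have [_ wdeg] := pP t tk.
have [y [Wy ky yw]] := homogeneous_representative wdeg Wx xw.
have /choice[prim primP] : forall z, exists c, W 3%N z -> d z = 0 ->
    [/\ W 2%N c, d c = z & forall k, degree k.+1 z -> degree k c].
  move=> z; have [[Wz dz]|nz] := pselect (W 3%N z /\ d z = 0).
    by have [c cP] := weight_exact WF Wz dz; exists c.
  by exists 0 => Wz dz; case: nz.
pose base i j := if (i == t) && (j == t) then y else a i j.
pose straddles i j := [&& (i <= t)%N, (t <= j)%N & (i < j)%N].
(* [B m] unfolds the recursion over intervals [m] times; [k] times suffice, as
   the recursive calls are on shorter intervals within [1], [k]. *)
pose B := fix B m i j := if m is m'.+1 then
   (if straddles i j then prim (massey_sum p (B m') i j) else base i j) else base i j.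
have Bsum m i j :
    (forall i' j', (j' - i' < j - i)%N -> B m i' j' = B m.+1 i' j') ->
    massey_sum p (B m) i j = massey_sum p (B m.+1) i j.
  move=> eB; rewrite /massey_sum big_nat [RHS]big_nat.
  by apply: eq_bigr => r /andP[ir rj]; rewrite !eB //; lia.
have Bst m i j : (j - i <= m)%N -> B m i j = B m.+1 i j.
  elim: m i j => [|m IHm] i j ijm.
    by rewrite /=; case: ifP => // /and3P[]; lia.
  rewrite /= -/B; case: ifP => // _; congr prim; apply: Bsum => i' j' ij'.
  by apply: IHm; lia.
pose b := B k.
have bE i j : (j <= k)%N -> b i j =
    if straddles i j then prim (massey_sum p b i j) else base i j.
  by move=> jk; rewrite /b Bst //; lia.
have b_off i j : (j <= k)%N -> ~~ (i <= t <= j)%N -> b i j = a i j.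
  move=> jk tij; rewrite bE // /straddles /base.
  by case: ifP => [/and3P[]|_]; last case: ifP => [/andP[/eqP ? /eqP ?]|//]; lia.
pose good i j := (i, j) <> (1%N, k) ->
  [/\ W (if (i <= t <= j)%N then 2%N else 1%N) (b i j),
      degree (massey_degree p i j) (b i j) & d (b i j) = massey_sum p b i j].
(* For [(i, j) = (1, k)] this is about the value of the system. *)
have good_sum i j : (1 <= i)%N -> (j <= k)%N -> (i <= t <= j)%N ->
    (forall i' j', (i <= i')%N -> (i' <= j')%N -> (j' <= j)%N ->
      (j' - i' < j - i)%N -> good i' j') ->
    [/\ W 3%N (massey_sum p b i j), d (massey_sum p b i j) = 0
      & degree (massey_degree p i j).+1 (massey_sum p b i j)].
  move=> i1 jk tij ih.
  have [||dg d0] := @massey_sum_cocycle _ p b i j.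
  - by move=> l lr; apply: p0; lia.
  - move=> i' j' ii' ij' jj' lij.
    by have [_ ? ?] := ih i' j' ii' ij' jj' lij ltac:(case; lia).
  split=> //; apply: weight_sum => r; rewrite mem_index_iota => ir.
  apply: weight_sign.
  have [Wl _ _] := ih i r ltac:(lia) ltac:(lia) ltac:(lia) ltac:(lia) ltac:(case; lia).
  have [Wr _ _] := ih r.+1 j ltac:(lia) ltac:(lia) ltac:(lia) ltac:(lia) ltac:(case; lia).
  have [tr|tr] := leqP t r.
    apply: (weightM WF (s := 2) (t := 1)).
      by move: Wl; rewrite ifT //; lia.
    by move: Wr; rewrite ifF //; apply/negbTE; lia.
  apply: (weightM WF (s := 1) (t := 2)).
    by move: Wl; rewrite ifF //; apply/negbTE; lia.
  by move: Wr; rewrite ifT //; lia.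
have goodP i j : (1 <= i)%N -> (i <= j)%N -> (j <= k)%N -> good i j.
  have [m] := ubnP (j - i); elim: m i j => // m IHm i j ijm i1 ij jk ijk.
  have ih i' j' : (i <= i')%N -> (i' <= j')%N -> (j' <= j)%N ->
      (j' - i' < j - i)%N -> good i' j'.
    by move=> ? ? ? ?; apply: IHm; lia.
  have [tij|tij] := boolP (i <= t <= j)%N; last first.
    have [da ea] := aP i j i1 ij jk ijk; rewrite b_off //; split=> //.
      exact: Wa.
    rewrite ea /massey_sum big_nat [RHS]big_nat; apply: eq_bigr => r ir.
    by rewrite !b_off //; lia.
  have [ij'|ij'] := ltnP i j; last first.
    have it : i = t by lia.
    have jt : j = t by lia.
    subst i j; rewrite bE // /straddles ltnn !andbF /base eqxx.
    rewrite /massey_sum big_geq // (represents_d0 yw); split=> //.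
    by rewrite /massey_degree subnn subn0 big_nat1.
  have [W3 d0 dg] := good_sum i j i1 jk tij ih.
  have /andP[it tj] := tij.
  rewrite bE // /straddles it tj ij' /=.
  by have [W2 dE /(_ _ dg) dgE] := primP _ W3 d0.
have [||||W3 d0 dg] := good_sum 1%N k; try by [].
  by move=> i' j' ? ? ? ?; apply: goodP.
have [c [_ dc _]] := weight_exact WF W3 d0.
exists b; split; last by rewrite -dc; exact: represents_boundary.
split=> [i ik|i j i1 ij jk ijk]; last by have [] := goodP i j i1 ij jk ijk.
have [it|/eqP it] := eqVneq i t; last by rewrite b_off; [exact: aw|lia..].
by rewrite it bE; [rewrite /straddles ltnn !andbF /base eqxx | lia].
Qed.

End WeightFiltration.

(** * The filtration of the Koszul algebra by v-degree *)

Module KoszulWeight.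
Import mpoly StanleyReisner.

Section Coefficients.
Context {n : nat} (K : simplicial_complex n).
Local Notation Zv := {mpoly int[n]}.
Local Notation ring := (StanleyReisner.ring K).
Local Notation pi := (\pi_(StanleyReisner.ring K)).
Implicit Types (a b : ring) (m : 'X_{1..n}) (f g : Zv) (j : 'I_n).

Definition face_mnm m : bool := mnm_supp m \in faces K.

(** Coefficients of non-faces are set to 0, which makes [coef m] independent of
    the representative polynomial. *)
Definition coef m a : int := if face_mnm m then (repr a)@_m else 0.

Lemma pi_eq f g : (pi f = pi g) <-> (f - g \in ideal K).
Proof. by rewrite Quotient.idealrBE; split=> /eqP. Qed.

Lemma coef_pi m f : coef m (pi f) = if face_mnm m then f@_m else 0.
Proof.
rewrite /coef; case: ifP => // mK; apply/eqP.
have /pi_eq/ideal_msupp/(_ m) : pi (repr (pi f)) = pi f by rewrite reprK.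
rewrite mcoeff_msupp mcoeffB subr_eq0 -[_ == _]negbK.
by case: eqP => // _ /(_ isT); rewrite -/(face_mnm m) mK.
Qed.

Lemma coefP a b : (forall m, coef m a = coef m b) -> a = b.
Proof.
move=> ab; rewrite -[a]reprK -[b]reprK; apply/pi_eq/ideal_msupp => m.
rewrite mcoeff_msupp mcoeffB subr_eq0; apply: contraNN => mK.
by have := ab m; rewrite /coef /face_mnm mK => ->.
Qed.

Lemma coefB m : {morph coef m : a b / a - b}.
Proof.
move=> a b; rewrite -{1}[a]reprK -{1}[b]reprK -raddfB coef_pi /coef.
by case: ifP => _; rewrite ?mcoeffB ?subr0.
Qed.

HB.instance Definition _ m :=
  GRing.isZmodMorphism.Build ring int (coef m) (@coefB m).

Lemma coef_sign m (k : nat) a : coef m ((-1) ^+ k * a) = (-1) ^+ k * coef m a.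
Proof.
rewrite -[in LHS]signr_odd -[in RHS]signr_odd.
by case: odd; rewrite ?expr1 ?expr0 ?mulN1r ?mul1r ?raddfN.
Qed.

Lemma coef_v m j a :
  coef m (v K j * a) = if face_mnm m && (0 < m j)%N then coef (m - U_(j))%MM a else 0.
Proof.
rewrite -{1}[a]reprK /v -rmorphM coef_pi; case: ifP => //= mK.
have [mj|] := boolP (0 < m j)%N.
  have mE : (m = U_(j) + (m - U_(j)))%MM.
    by apply/mnmP => i; rewrite mnmDE mnmBE mnm1E; case: eqP => [<-|_]; lia.
  rewrite {1}mE mulrC mcoeffMX /coef ifT //.
  by apply: (facesS _ mK); apply/subsetP => i; rewrite !inE mnmBE; lia.
rewrite -eqn0Ngt => /eqP mj; apply/eqP; rewrite mcoeff_eq0; apply/negP.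
move=> /msuppM_le /allpairsP[[m1 m2] /= []].
rewrite msuppX inE => /eqP -> _ mE.
by move: mj; rewrite mE mnmDE mnm1E eqxx.
Qed.

(** Finitely supported families of coefficients come from elements, which is how
    the contracting homotopy below is defined monomial by monomial. *)
Lemma ring_of_coef (f : 'X_{1..n} -> int) N :
  (forall m, f m != 0 -> (mdeg m < N)%N) ->
  exists a : ring, forall m, coef m a = if face_mnm m then f m else 0.
Proof.
move=> fN; exists (pi (\sum_(m : 'X_{1..n < N}) f m *: 'X_[m])) => m.
rewrite coef_pi raddf_sum /=; case: ifP => // _.
under eq_bigr do rewrite mcoeffZ mcoeffX.
have [mN|Nm] := ltnP (mdeg m) N.
  rewrite (bigD1 (BMultinom mN)) //= eqxx mulr1 big1 ?addr0 // => m' /negPf m'm.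
  by case: eqP => [m'E|_]; rewrite ?mulr0 //; case/negP: m'm; apply/eqP/val_inj.
rewrite big1 => [|m' _].
  by apply/eqP; rewrite eq_sym; apply: contraTT Nm => /fN; rewrite -ltnNge.
case: eqP => [m'E|_]; last by rewrite mulr0.
by have := bmdeg m'; rewrite m'E ltnNge Nm.
Qed.

(** Passes between conditions on the coefficients of a class and the existence of
    a polynomial all of whose monomials satisfy them, the form in which
    [homogeneous] is defined. *)
Lemma coef_support a (P : pred 'X_{1..n}) :
  (forall m, coef m a != 0 -> P m) <->
  (exists f : Zv, a = pi f /\ {in msupp f, forall m, P m}).
Proof.
split=> [aP|[f [-> fP]] m]; last first.
  by rewrite coef_pi; case: ifP => // _; rewrite -mcoeff_msupp; exact: fP.
exists (\sum_(m <- msupp (repr a)) coef m a *: 'X_[m]); split.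
  apply: coefP => m; rewrite coef_pi raddf_sum /=.
  under eq_bigr do rewrite mcoeffZ mcoeffX.
  rewrite [in LHS]/coef; case: ifP => // mK.
  have [ma|ma] := boolP (m \in msupp (repr a)).
    rewrite (bigD1_seq m) //= ?msupp_uniq // eqxx mulr1 big1 ?addr0 => [|m' /negPf ->].
      by rewrite /coef mK.
    by rewrite mulr0.
  rewrite (memN_msupp_eq0 ma) big_seq big1 // => m' m'a.
  by case: eqP => [m'm|_]; rewrite ?mulr0 //; rewrite m'm (negPf ma) in m'a.
move=> m; rewrite mcoeff_msupp raddf_sum /= => nz; apply: aP.
apply: contraNN nz => /eqP ma; rewrite big1 // => m' _.
by rewrite mcoeffZ mcoeffX; case: eqP => [->|_]; rewrite ?ma ?mul0r ?mulr0.
Qed.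

Lemma coefM_neq0 m a b : coef m (a * b) != 0 -> exists m1 m2,
  [/\ m = (m1 + m2)%MM, coef m1 a != 0 & coef m2 b != 0].
Proof.
move=> mab.
have [f [aE fa]] := (coef_support a (fun m => coef m a != 0)).1 (fun _ => id).
have [g [bE gb]] := (coef_support b (fun m => coef m b != 0)).1 (fun _ => id).
move: mab; rewrite {1}aE {1}bE -rmorphM coef_pi; case: ifP => // _.
rewrite -mcoeff_msupp => /msuppM_le /allpairsP[[m1 m2] /= [m1f m2g ->]].
by exists m1, m2; split; [|exact: fa|exact: gb].
Qed.

Lemma homogeneousE c k a :
  homogeneous c k a <-> forall m, coef m a != 0 -> (c + 2 * mdeg m)%N = k.
Proof.
have := coef_support a (fun m => (c + 2 * mdeg m)%N == k).
split=> [[f [aE fP]] m ma|aP].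
  by apply/eqP; apply: (H.2 _ m ma); exists f; split=> // m' /fP/eqP.
have [f [aE fP]] := H.1 (fun m ma => introT eqP (aP m ma)).
by exists f; split=> // m /fP/eqP.
Qed.


Local Notation E := (exterior n ring).
Local Notation d := (koszul_d (v K)).
Implicit Types (x y z c : E) (I J : {set 'I_n}).

Lemma coef_d x J m : coef m (d x J) = \sum_(j | j \notin J) (-1) ^+ nbelow J j *
   (if face_mnm m && (0 < m j)%N then coef (m - U_(j))%MM (x (j |: J)) else 0).
Proof.
by rewrite ffunE raddf_sum; apply: eq_bigr => j _ /=; rewrite coef_sign coef_v.
Qed.

Definition weight (s : nat) (x : E) : Prop :=
  forall J m, coef m (x J) != 0 -> (s <= mdeg m)%N.

Lemma koszul_weightM s t x y : weight s x -> weight t y -> weight (s + t) (x * y).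
Proof.
move=> sx ty J m; apply: contraNT => st; rewrite extM raddf_sum big1 //= => I _.
rewrite coef_sign; apply/eqP; rewrite mulf_eq0; apply/orP; right.
apply: contraNT st => /coefM_neq0[m1 [m2 [-> /sx s1 /ty t2]]].
by rewrite mdegD leq_add.
Qed.

Lemma koszul_weightD s x y : weight s x -> weight s y -> weight s (x + y).
Proof.
move=> sx sy J m; rewrite ffunE raddfD /= => xy.
have [xJ|/sx//] := eqVneq (coef m (x J)) 0.
by apply: (sy J); rewrite xJ add0r in xy.
Qed.

Lemma koszul_degreeE k x : koszul_degree k x <->
  forall J m, coef m (x J) != 0 -> (#|J| + 2 * mdeg m)%N = k.
Proof.
by split=> h J; have := h J; [move/homogeneousE | move=> H; apply/homogeneousE].
Qed.

(** The degree of [u_J v^m] is [#|J| + 2 * mdeg m], so distinct homogeneous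
    components involve distinct monomials and none can leave filtration [s]. *)
Lemma koszul_weight_split s x : weight s x -> exists N (y : nat -> E),
  (forall k, koszul_degree k (y k) /\ weight s (y k)) /\ x = \sum_(k < N) y k.
Proof.
move=> sx; have [N [y [yP xy]]] := koszul_degree_total x.
exists N, (fun k => if (k < N)%N then y k else 0); split=> [k|]; last first.
  by rewrite xy; apply: eq_bigr => i _; rewrite ltn_ord.
case: ltnP => kN; last first.
  by split; [exact: koszul_degree0 | move=> J m; rewrite ffunE raddf0 eqxx].
split=> // J m yJ; apply: (sx J); rewrite xy sum_ffunE raddf_sum /=.
rewrite (bigD1 (Ordinal kN)) //= big1 ?addr0 // => i ik.
apply/eqP; apply: contraNT ik => yi; apply/eqP/val_inj => /=.
by rewrite -((koszul_degreeE _ _).1 (yP i) _ _ yi) ((koszul_degreeE _ _).1 (yP k) _ _ yJ).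
Qed.

(** For [j] in [J], the monomial [u_J] is the only one whose differential involves
    [u_(J :\ j) v_j], which is nonzero as [j] is a vertex. *)
Lemma koszul_weight_pos k x : koszul_degree k.+1 x -> weight 2 (d x) -> weight 1 x.
Proof.
move=> /koszul_degreeE xk dx J m xJ; rewrite lt0n; apply/negP => m0.
have {m0} m0 : m = 0%MM by apply/eqP; rewrite -mdeg_eq0.
have [J0|[j jJ]] := set_0Vmem J.
  by have := xk _ _ xJ; rewrite J0 m0 cards0 mdeg0.
have /eqP : coef U_(j)%MM (d x (J :\ j)) = 0.
  by apply/eqP; apply: contraT => /dx; rewrite mdeg1.
rewrite coef_d (bigD1 j) ?setD11 //= big1 => [|l /andP[_ lj]].
  have fj : face_mnm U_(j)%MM.
    rewrite /face_mnm; suff -> : mnm_supp U_(j)%MM = [set j] by exact: faces1.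
    by apply/setP => l; rewrite !inE mnm1E (eq_sym j) eqb0 negbK.
  rewrite fj mnm1E eqxx setD1K // addr0 mulf_eq0 signr_eq0 /=.
  suff -> : (U_(j) - U_(j) = 0)%MM by rewrite -m0 (negPf xJ).
  by apply/mnmP => l; rewrite mnmBE mnm0E subnn.
by rewrite mnm1E (eq_sym j) (negPf lj) andbF mulr0.
Qed.

(** The choice depends only on the multidegree of [u_J v^m], which [d] preserves
    ([repeated_d]); this is why the homotopies for different multidegrees fit
    together. *)
Definition repeated J m : option 'I_n := [pick i | (1 < (i \in J) + m i)%N].

Lemma repeated_d J m j : j \notin J -> (0 < m j)%N ->
  repeated (j |: J) (m - U_(j))%MM = repeated J m.
Proof.
move=> jJ mj; apply: eq_pick => i; rewrite !inE mnmBE mnm1E (eq_sym j).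
by case: eqP => [->|_]; rewrite ?subn0 //= (negPf jJ) add0n add1n subn1 prednK.
Qed.

Lemma coef_bounded x : exists N, forall J m, coef m (x J) != 0 -> (mdeg m < N)%N.
Proof.
exists (\max_(J : {set 'I_n}) msize (repr (x J)))%N => J m xJ.
apply: leq_trans (leq_bigmax J); apply: msize_mdeg_lt.
by move: xJ; rewrite /coef mcoeff_msupp; case: ifP; rewrite ?eqxx.
Qed.

(** The homotopy replaces one [v_i] by [u_i], where [i] is the repeated variable
    of the multidegree; read backwards, the coefficient at [u_J v^m] comes from
    the monomial of [u_(J :\ i)] and [v^m v_i]. *)
Definition homotopy_coef (x : E) J m : int :=
  if repeated J m is Some i then
    if i \in J then (-1) ^+ nbelow J i * coef (m + U_(i))%MM (x (J :\ i)) else 0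
  else 0.

Lemma homotopy_exists x : exists c, forall J m, 
   coef m (c J) = if face_mnm m then homotopy_coef x J m else 0.
Proof.
have [N xN] := coef_bounded x.
have /choice[c cP] J : exists a : ring, forall m,
    coef m a = if face_mnm m then homotopy_coef x J m else 0.
  apply: (@ring_of_coef _ N) => m; rewrite /homotopy_coef.
  case: repeated => [i|]; rewrite ?eqxx //; case: ifP; rewrite ?eqxx // => _.
  rewrite mulf_eq0 signr_eq0 /= => /xN; rewrite mdegD mdeg1; lia.
by exists [ffun J => c J] => J m; rewrite ffunE.
Qed.

(** With [h] the homotopy, [d h + h d] is the identity on multidegrees with a
    repeated variable [i]: replacing [v_i] by [u_i] and back gives the identity,
    and the other terms of [d] anticommute with [h], since the support of the
    [v]-monomial contains [i] before and after the replacement, so that the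
    same products vanish on both sides.
    All monomials of [x] have a repeated variable, since [mdeg m >= s] exceeds
    the size of every face. *)
Lemma homotopy_d s x c : (forall F, F \in faces K -> (#|F| < s)%N) ->
  weight s x -> d x = 0 ->
  (forall J m, coef m (c J) = if face_mnm m then homotopy_coef x J m else 0) ->
  d c = x.
Proof.
move=> Ks sx dx cP; apply/ffunP => J; apply: coefP => m.
have [mK|mK] := boolP (face_mnm m); last first.
  by rewrite /coef (negPf mK).
rewrite coef_d mK /=.
have cE j : j \notin J -> (0 < m j)%N -> coef (m - U_(j))%MM (c (j |: J)) =
    homotopy_coef x (j |: J) (m - U_(j))%MM.
  move=> jJ mj; rewrite cP ifT //; apply: (facesS _ mK).
  by apply/subsetP => i; rewrite !inE mnmBE; lia.
under eq_bigr => j jJ.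
  rewrite (_ : (if _ then _ else _) = if (0 < m j)%N then
     homotopy_coef x (j |: J) (m - U_(j))%MM else 0); last first.
    by case: ifP => // mj; exact: cE.
  over.
rewrite /homotopy_coef; case rep : (repeated J m) => [i|]; last first.
  rewrite big1 => [|j jJ]; last first.
    by case: ifP => [mj|]; rewrite ?mulr0 // repeated_d // rep mulr0.
  apply/esym/eqP; apply: contraTT mK => /sx; apply: contraL => mK.
  rewrite -ltnNge; apply: leq_ltn_trans (Ks _ mK).
  rewrite mdegE -sum1_card [leqRHS]big_mkcond; apply: leq_sum => i _; rewrite inE.
  move: rep; rewrite /repeated; case: pickP => // /(_ i).
  by case: (m i) => [|[|k]] //; rewrite !addnS.
have iP : (1 < (i \in J) + m i)%N.
  by move: rep; rewrite /repeated; case: pickP => // i' ? [<-].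
under eq_bigr => j jJ.
  rewrite (_ : (if _ then _ else _) = if (0 < m j)%N && (i \in j |: J) then
     (-1) ^+ nbelow (j |: J) i *
     coef (m - U_(j) + U_(i))%MM (x ((j |: J) :\ i)) else 0); last first.
    by case: ifP => //= mj; rewrite repeated_d // rep.
  over.
have [iJ|iJ] := boolP (i \in J); last first.
  rewrite (bigD1 i) //= big1 => [|j /andP[jJ ji]]; last first.
    by rewrite !inE eq_sym (negPf ji) (negPf iJ) andbF mulr0.
  move: iP; rewrite (negPf iJ) add0n => mi; rewrite ltnW // !inE eqxx /= setU1K //.
  rewrite addr0 submK; last first.
    by apply/mnm_lepP => l; rewrite mnm1E; case: eqP => [<-|]//; exact: ltnW.
  by rewrite mulrA -exprD /nbelow sum_setU1 // ltnn add0n addnn -signr_odd odd_double mul1r.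
have mi : (0 < m i)%N by move: iP; rewrite iJ; lia.
have mK' : face_mnm (m + U_(i))%MM.
  rewrite /face_mnm; suff -> : mnm_supp (m + U_(i))%MM = mnm_supp m by [].
  apply/setP => l; rewrite !inE mnmDE mnm1E; case: (eqVneq i l) => [<-|_];
    last by rewrite addn0.
  by rewrite addn1 -!lt0n mi.
(* The coefficient of [u_(J :\ i) v^m v_i] in [d x] expresses the one of
   [u_J v^m] in [x] by those in [d c]. *)
have : coef (m + U_(i))%MM (d x (J :\ i)) = 0 by rewrite dx ffunE raddf0.
rewrite coef_d mK' (bigD1 i) ?setD11 //= mnmDE mnm1E eqxx addn1 /= setD1K //.
rewrite (_ : (m + U_(i) - U_(i))%MM = m); last first.
  by apply/mnmP => l; rewrite mnmBE mnmDE addnK.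
set S := \sum_(_ | _) _ => /eqP; rewrite addr_eq0 => /eqP xS.
have -> : coef m (x J) = - ((-1) ^+ nbelow (J :\ i) i * S).
  by rewrite -mulrN -xS mulrA -exprD addnn -signr_odd odd_double mul1r.
rewrite /S mulr_sumr -sumrN; apply: eq_big => [l|l lJ].
  by rewrite !inE; case: eqP => [->|]; rewrite ?iJ ?andbT.
have li : l != i by apply: contraNneq lJ => ->.
rewrite !inE iJ orbT andbT mnmDE mnm1E eq_sym (negPf li) /= addn0.
case: ifP => ml; last by rewrite !mulr0 oppr0.
have -> : (l |: J) :\ i = l |: J :\ i.
  by apply/setP => u; rewrite !inE; case: eqP => [->|//]; rewrite eq_sym (negPf li).
have -> : (m - U_(l) + U_(i) = m + U_(i) - U_(l))%MM.
  apply/mnmP => u; rewrite !(mnmDE, mnmBE, mnm1E).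
  by case: (eqVneq l u) => [<-|_]; lia.
set X := coef _ _.
have nJ u : nbelow J u = ((i < u) + nbelow (J :\ i) u)%N.
  by rewrite -{1}(setD1K iJ) /nbelow sum_setU1 // setD11.
rewrite {2}/nbelow sum_setU1 // -!/(nbelow _ _) !nJ ltnn add0n.
move: li; rewrite -val_eqE /= => li.
move: (nbelow (J :\ i) l) (nbelow (J :\ i) i) => p q.
rewrite !mulrA -!exprD -mulNr; congr (_ * X).
rewrite -[LHS]signr_odd -[X in _ = - X]signr_odd.
have -> : odd ((i < l)%N + p + ((l < i)%N + q)) = ~~ odd (q + p).
  by case: ltngtP li => // _ _; rewrite !oddD /=; do 2!case: odd.
by case: odd; rewrite /= ?opprK.
Qed.

Lemma koszul_weight_exact s z : (forall F, F \in faces K -> (#|F| <= s)%N) ->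
  weight s.+1 z -> d z = 0 -> exists c,
  [/\ weight s c, d c = z & forall k, koszul_degree k.+1 z -> koszul_degree k c].
Proof.
move=> Ks sz dz; have [c cP] := homotopy_exists z.
have cz J m : coef m (c J) != 0 -> exists2 i, i \in J &
    coef (m + U_(i))%MM (z (J :\ i)) != 0.
  rewrite cP /homotopy_coef; case: ifP; rewrite ?eqxx // => _.
  case: repeated => [i|]; rewrite ?eqxx //; case: ifP; rewrite ?eqxx // => iJ.
  by rewrite mulf_eq0 signr_eq0 /=; exists i.
exists c; split; last 1 first.
- move=> k /koszul_degreeE kz; apply/koszul_degreeE => J m /cz[i iJ /kz].
  by rewrite mdegD mdeg1 (cardsD1 i J) iJ; lia.
- by move=> J m /cz[i iJ /sz]; rewrite mdegD mdeg1; lia.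
- exact: (homotopy_d _ sz).
Qed.

Lemma koszul_weight_filtration : (forall F, F \in faces K -> (#|F| <= 2)%N) ->
  @weight_filtration (koszul_dga K) weight.
Proof.
move=> K2; split.
- by move=> s J m; rewrite ffunE raddf0 eqxx.
- by move=> s x sx J m; rewrite ffunE raddfN oppr_eq0; exact: sx.
- exact: koszul_weightD.
- by move=> s t x st tx J m /tx; exact: leq_trans.
- by [].
- exact: koszul_weightM.
- exact: koszul_weight_split.
- exact: koszul_weight_pos.
- by move=> z; exact: koszul_weight_exact.
Qed.

End Coefficients.
End KoszulWeight.

(** * Vanishing for graphs *)

Section GraphComplexes.
Context {n : nat} (e : rel 'I_n).

Lemma graph_faces_card F : F \in faces (graph_complex e) -> (#|F| <= 2)%N.
Proof.
rewrite inE => /orP[/leqW//|/existsP[i /existsP[j /andP[_ /eqP ->]]]].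
by rewrite cards2; case: (_ != _).
Qed.

Let WF := KoszulWeight.koszul_weight_filtration graph_faces_card.

(** A product of at least two classes of positive degree has a representative in
    filtration 2. *)
Lemma massey_vanishes_product k (w : nat -> Tor (graph_complex e)) t m :
  (2 <= k)%N -> (1 <= t <= k)%N -> (2 <= m)%N -> is_product m (w t) ->
  massey_vanishes k w.
Proof.
move=> k2 tk m2 /(product_weight WF)[x Wx xw].
exact: (massey_vanishes_of_weight WF k2 tk (weight_le WF m2 Wx) xw).
Qed.

Lemma graph_annihilating : annihilating (graph_complex e) 2.
Proof.
split=> [|k w k2 _ [i [j [mi [mj [/andP[ik _] /andP[jk _] [_ wi] [_ wj] mij]]]]]].
  have p3 := triple_products_vanish WF.
  have ex : exists l, `[< products_vanish (koszul_dga (graph_complex e)) l >].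
    by exists 3; exact/asboolP.
  exists (ex_minn ex); case: ex_minnP => l /asboolP lv lmin.
  split; last by apply: lmin; exact/asboolP.
  by split=> // l' /asboolP; exact: lmin.
have [mi2|mi1] := leqP 2 mi; first exact: massey_vanishes_product mi2 wi.
by apply: massey_vanishes_product wj => //; lia.
Qed.

Lemma graph_massey_decomposable k (w : nat -> Tor (graph_complex e)) :
  (2 <= k)%N -> (forall i, (1 <= i <= k)%N -> decomposable (w i)) ->
  massey_vanishes k w.
Proof.
move=> k2 /(_ 1%N (ltnW k2))[m [m2 w1]].
by refine (@massey_vanishes_product k w 1%N m k2 _ m2 w1); exact: ltnW.
Qed.

End GraphComplexes.

(** * Contractible open sets in moment-angle complexes *)

From mathcomp Require Import ring lra.
From mathcomp Require Import all_classical all_reals all_analysis.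
Import numFieldNormedType.Exports.

Local Open Scope classical_set_scope.
Local Open Scope ring_scope.

Section Contractions.
Context (R : realType) {X : topologicalType}.
Implicit Types (U : set X) (c : X).

Definition contracts_to c U : Prop := exists H : X * R -> X,
  [/\ {within U `*` `[0, 1], continuous H}, forall x, U x -> H (x, 0) = x
    & forall x, U x -> H (x, 1) = c].

(** A disjoint union of open sets contracts when all parts contract to the same
    point: the homotopies agree locally with one of the given ones. *)
Lemma contracts_to_bigcup c (I : Type) (P : set I) (V : I -> set X) :
  (forall i, P i -> open (V i)) -> trivIset P V ->
  (forall i, P i -> contracts_to c (V i)) -> contracts_to c (\bigcup_(i in P) V i).
Proof.
move=> oV tV cV.
have /choice[h hP] i : exists h : X * R -> X, P i ->
    [/\ {within V i `*` `[0, 1], continuous h}, forall x, V i x -> h (x, 0) = x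
      & forall x, V i x -> h (x, 1) = c].
  have [Pi|nP] := pselect (P i); last by exists fst => /nP.
  by have [h hP] := cV i Pi; exists h.
pose H (p : X * R) : X :=
  if pselect (exists2 i, P i & V i p.1) is left e then h (sval (cid2 e)) p else p.1.
have HE i p : P i -> V i p.1 -> H p = h i p.
  move=> Pi Vi; rewrite /H; case: pselect => [e|[]]; last by exists i.
  case: (cid2 e) => j Pj Vj /=; suff -> : j = i by [].
  by apply: tV => //; exists p.1.
move: H HE => H HE; exists H; split=> [|x [i Pi Vix]|x [i Pi Vix]]; last 2 first.
- by rewrite (HE i) //; have [_ -> ] := hP i Pi.
- by rewrite (HE i) //; have [_ _ -> ] := hP i Pi.
apply/subspace_continuousP => -[x t] [[i Pi /= Vix] /= t01].
have [hc _ _] := hP i Pi; move/subspace_continuousP: hc => /(_ (x, t)).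
have nV : \forall p \near (x, t), V i p.1.
  apply: (@cvg_fst X R (nbhs x) (nbhs t) _ (V i)).
  by apply: open_nbhs_nbhs; split=> //; exact: oV.
move=> /(_ (conj Vix t01)) hc A; rewrite /from_subspace (HE i) // => /hc hA.
have {}hA : \forall p \near (x, t), (V i `*` `[0, 1]) p -> A (h i p) := hA.
suff : \forall p \near (x, t), ((\bigcup_(i in P) V i) `*` `[0, 1]) p -> A (H p) by [].
apply: filterS2 nV hA => p Vp hA [_ t01']; rewrite (HE i) //; exact: hA.
Qed.

End Contractions.

(** * The topology and the moves of a moment-angle complex *)

Lemma cvg_initial {S : choiceType} {X : topologicalType} (f : S -> X) (T : Type)
    (F : set_system T) {FF : Filter F} (g : T -> S) (x : S) :
  (f \o g) @ F --> f x -> g @ F --> (x : initial_topology f).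
Proof.
move=> gx A [_ [[B oB <-] Bx BA]]; rewrite nbhs_filterE.
have gB : F (g @^-1` (f @^-1` B)) by apply: gx; exact: open_nbhs_nbhs.
suff : F (g @^-1` A) by [].
by apply: filterS gB => y; exact: BA.
Qed.

Section MomentAngleContractions.
Context {R : realType} {n : nat} (K : simplicial_complex n).
Local Notation Z := (moment_angle R K).
Local Notation disk := (@unit_disk R).
Local Notation circle := (@unit_circle R).
Implicit Types (S F : {set 'I_n}) (z : Z) (a b : R * R) (s t : R) (l i : 'I_n).

Definition coord l z : R * R := (\val z : 'I_n -> R * R) l.

(** The topology of the moment-angle complex is initial for the coordinates. *)
Lemma cvg_coord (T : Type) (F : set_system T) {FF : Filter F} (g : T -> Z) z :
  (forall l, coord l (g y) @[y --> F] --> coord l z) -> g @ F --> z.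
Proof.
move=> gz; apply: cvg_initial.
apply/(@cvg_sup _ _ (fun l => Topological.class
  (initial_topology (fun f : 'I_n -> (R * R)%type => f l)))) => l.
by apply: cvg_initial; exact: gz.
Qed.

Lemma coord_continuous l : continuous (coord l).
Proof.
move=> z; apply: (@continuous_comp Z {ptws 'I_n -> (R * R)%type} (R * R)%type
  \val (fun f => f l) z); first exact: initial_continuous.
exact: (@proj_continuous 'I_n (fun=> (R * R)%type)).
Qed.

Definition sqnorm a : R := a.1 ^+ 2 + a.2 ^+ 2.

Lemma diskE a : disk a = (sqnorm a <= 1) :> Prop.
Proof. by []. Qed.

Lemma circleE a : circle a = (sqnorm a = 1) :> Prop.
Proof. by []. Qed.

Lemma sqnorm_ge0 a : 0 <= sqnorm a.
Proof. by rewrite addr_ge0 ?sqr_ge0. Qed.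

Lemma sqnorm_continuous : continuous sqnorm.
Proof.
move=> a; apply: cvgD; apply: cvgM; by [exact: cvg_fst|exact: cvg_snd].
Qed.

Definition slide s a : R * R := ((1 - s) * a.1 + s, (1 - s) * a.2).
(** Radial scaling, from the identity at [s = 0] to the normalization at
    [s = 1]. *)
Definition push s a : R * R :=
  let u := 1 - s + s / Num.sqrt (sqnorm a) in (u * a.1, u * a.2).

Lemma slide_disk s a : 0 <= s <= 1 -> disk a -> disk (slide s a).
Proof.
rewrite /unit_disk /= => /andP[s0 s1] da.
have a1 : a.1 <= 1 by nra.
have -> : ((1 - s) * a.1 + s) ^+ 2 + ((1 - s) * a.2) ^+ 2 =
  (1 - s) ^+ 2 * (a.1 ^+ 2 + a.2 ^+ 2) + 2 * (s * (1 - s)) * a.1 + s ^+ 2 by ring.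
have : (1 - s) ^+ 2 * (a.1 ^+ 2 + a.2 ^+ 2) <= (1 - s) ^+ 2 * 1.
  by rewrite ler_wpM2l // sqr_ge0.
have : 2 * (s * (1 - s)) * a.1 <= 2 * (s * (1 - s)) * 1.
  by rewrite ler_wpM2l // mulr_ge0 // mulr_ge0 // subr_ge0.
nra.
Qed.

Lemma slide0 a : slide 0 a = a.
Proof. by rewrite /slide subr0 !mul1r addr0 -surjective_pairing. Qed.

Lemma slide1 a : slide 1 a = (1, 0).
Proof. by rewrite /slide subrr !mul0r add0r. Qed.

Lemma push0 a : push 0 a = a.
Proof. by rewrite /push mul0r subr0 addr0 !mul1r -surjective_pairing. Qed.

Lemma sqnorm_push s a : 0 < sqnorm a ->
  sqnorm (push s a) = ((1 - s) * Num.sqrt (sqnorm a) + s) ^+ 2.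
Proof.
move=> a0; set r := Num.sqrt _; have r0 : r != 0 by rewrite gt_eqF // sqrtr_gt0.
transitivity ((1 - s + s / r) ^+ 2 * sqnorm a).
  by rewrite /sqnorm /push /= -/r; ring.
rewrite -[in LHS](@sqr_sqrtr _ (sqnorm a)) ?sqnorm_ge0 // -/r.
by field.
Qed.

Lemma push_disk s a : 0 <= s <= 1 -> 0 < sqnorm a -> disk a -> disk (push s a).
Proof.
move=> /andP[s0 s1] a0; rewrite !diskE => da; rewrite sqnorm_push //.
have r1 : Num.sqrt (sqnorm a) <= 1 by rewrite -sqrtr1 ler_sqrt.
have r0 := sqrtr_ge0 (sqnorm a).
rewrite expr_le1 //.
  by nra.
by nra.
Qed.

Lemma push_circle s a : circle a -> circle (push s a).
Proof.
rewrite !circleE => a1; rewrite sqnorm_push ?a1 //.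
by rewrite sqrtr1 mulr1 subrK expr1n.
Qed.

Lemma push1_circle a : 0 < sqnorm a -> circle (push 1 a).
Proof.
move=> a0; rewrite circleE sqnorm_push //.
by rewrite subrr mul0r add0r expr1n.
Qed.

Lemma circle_disk a : circle a -> disk a.
Proof. by rewrite circleE diskE => ->. Qed.

Definition clamp s : R := Num.max 0 (Num.min s 1).

Lemma clamp_itv s : 0 <= clamp s <= 1.
Proof. by rewrite le_max lexx /= ge_max ler01 ge_min lexx orbT. Qed.

Lemma clamp_le0 s : s <= 0 -> clamp s = 0.
Proof. by move=> s0; apply/max_idPl; rewrite ge_min s0. Qed.

Lemma clamp_ge1 s : 1 <= s -> clamp s = 1.
Proof. by move=> s1; rewrite /clamp (min_idPr s1); apply/max_idPr. Qed.

Lemma clamp_continuous : continuous clamp.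
Proof.
move=> s; have cmin : {for s, continuous ((id : R -> R^o) \min (cst 1 : R -> R^o))}.
  by apply: continuous_min; [exact: cvg_id|exact: cvg_cst].
have := @continuous_max R R (cst 0) _ s (cvg_cst _) cmin.
exact.
Qed.

(** * The contractible cover *)

Lemma cvg_plane (T : Type) (F : set_system T) {FF : Filter F} (f g : T -> R) (x y : R) :
  f @ F --> x -> g @ F --> y -> (f u, g u) @[u --> F] --> ((x, y) : R * R).
Proof. by move=> fx gy; apply: (@cvg_pair _ _ _ _ (nbhs x) (nbhs y)). Qed.

Lemma cvg_slide (T : Type) (F : set_system T) {FF : Filter F} (f : T -> R) (g : T -> R * R) s a :
  f @ F --> s -> g @ F --> a -> slide (f y) (g y) @[y --> F] --> slide s a.
Proof.
move=> fs ga; have g1 : (g y).1 @[y --> F] --> a.1 by apply: (cvg_comp _ _ ga); exact: cvg_fst.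
have g2 : (g y).2 @[y --> F] --> a.2 by apply: (cvg_comp _ _ ga); exact: cvg_snd.
have f1 : 1 - f y @[y --> F] --> 1 - s by apply: cvgB; [exact: cvg_cst|].
by apply: cvg_plane; [apply: cvgD => //|]; exact: cvgM.
Qed.

Lemma cvg_push (T : Type) (F : set_system T) {FF : Filter F} (f : T -> R) (g : T -> R * R) s a :
  0 < sqnorm a ->
  f @ F --> s -> g @ F --> a -> push (f y) (g y) @[y --> F] --> push s a.
Proof.
move=> a0 fs ga; have g1 : (g y).1 @[y --> F] --> a.1 by apply: (cvg_comp _ _ ga); exact: cvg_fst.
have g2 : (g y).2 @[y --> F] --> a.2 by apply: (cvg_comp _ _ ga); exact: cvg_snd.
have gn : Num.sqrt (sqnorm (g y)) @[y --> F] --> Num.sqrt (sqnorm a).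
  apply: (@cvg_comp _ _ _ _ Num.sqrt _ (nbhs (sqnorm a))); last exact: sqrt_continuous.
  by apply: (cvg_comp _ _ ga); exact: sqnorm_continuous.
have u : 1 - f y + f y / Num.sqrt (sqnorm (g y)) @[y --> F] -->
    1 - s + s / Num.sqrt (sqnorm a).
  apply: cvgD; first by apply: cvgB; [exact: cvg_cst|].
  by apply: cvgM => //; apply: cvgV => //; rewrite gt_eqF // sqrtr_gt0.
by apply: cvg_plane; exact: cvgM.
Qed.

Lemma cvg_clamp (T : Type) (F : set_system T) {FF : Filter F} (f : T -> R) s :
  f @ F --> s -> clamp (f y) @[y --> F] --> clamp s.
Proof. by move=> fs; apply: (cvg_comp _ _ fs); exact: clamp_continuous. Qed.

(** A neighbourhood of the points with zero set [S], small enough to miss the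
    neighbourhoods for the other sets of the same size. *)
Definition dominated S : set Z := [set z |
  (forall i l, i \in S -> l \notin S -> sqnorm (coord i z) < sqnorm (coord l z)) /\
  (forall l, l \notin S -> 0 < sqnorm (coord l z))].

Lemma sqnorm_coord_continuous l : continuous (fun z => sqnorm (coord l z)).
Proof.
move=> z; apply: (@continuous_comp Z (R * R)%type R (coord l) sqnorm z).
  exact: coord_continuous.
exact: sqnorm_continuous.
Qed.

Lemma open_dominated S : open (dominated S).
Proof.
rewrite openE => z [zS z0]; apply: filterI; last first.
  pose V l := [set y : Z | l \notin S -> 0 < sqnorm (coord l y)].
  apply: (@filter_forall Z _ V (nbhs z) _).
  move=> l; have [lS|lS] := boolP (l \in S).
    by apply: nearW => y /negP[].
  apply: filterS (cvgr_gt _ (@sqnorm_coord_continuous l z) _ (z0 l lS)).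
  by move=> y ? _.
pose V i l := [set y : Z | i \in S -> l \notin S -> sqnorm (coord i y) < sqnorm (coord l y)].
apply: (@filter_forall Z _ (fun i => [set y : Z | forall l, V i l y]) (nbhs z) _) => i.
apply: (@filter_forall Z _ (V i) (nbhs z) _) => l.
have [/andP[iS lS]|nS] := boolP ((i \in S) && (l \notin S)); last first.
  by apply: nearW => y /= iS lS; rewrite iS lS in nS.
have c : (fun y : Z => sqnorm (coord l y) - sqnorm (coord i y)) @ z -->
    sqnorm (coord l z) - sqnorm (coord i z).
  exact: (cvgB (@sqnorm_coord_continuous l z) (@sqnorm_coord_continuous i z)).
have zil : 0 < sqnorm (coord l z) - sqnorm (coord i z).
  by rewrite subr_gt0; exact: zS.
by apply: filterS (cvgr_gt _ c _ zil) => y yil _ _; rewrite -subr_gt0.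
Qed.

(** During the first of [n.+1] equal periods of time, the coordinates in [S]
    slide to 1 and the others move to the circle; coordinate [l] slides to 1
    during the [l.+1]-st of the following ones.  Clamping the local times makes
    a single formula of these [n.+1] successive homotopies. *)
Definition contraction_path S (p : Z * R) : 'I_n -> R * R := fun l =>
  slide (clamp (n.+1%:R * p.2 - l.+1%:R))
    (let s := clamp (n.+1%:R * p.2) in
     if l \in S then slide s (coord l p.1) else push s (coord l p.1)).

Lemma contraction_path0 S z : contraction_path S (z, 0) = \val z.
Proof.
apply/funext => l; rewrite /contraction_path /= mulr0 sub0r !clamp_le0 ?lexx // ?oppr_le0 ?ler0n //.
by rewrite slide0 slide0 push0 if_same.
Qed.

Lemma contraction_path1 S z : contraction_path S (z, 1) = fun=> (1, 0).
Proof.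
apply/funext => l; rewrite /contraction_path /= mulr1 clamp_ge1 ?slide1 //.
by rewrite lerBrDr addrC natr1 ler_nat ltnS ltn_ord.
Qed.

Lemma moment_angle_setP (z : {ptws 'I_n -> (R * R)%type}) :
  moment_angle_set K z <-> exists2 F, F \in faces K &
    forall i, if i \in F then disk (z i) else circle (z i).
Proof.
by split=> -[F FK zF]; exists F => // i; have := zF i; case: ifP.
Qed.

Lemma coord_disk l z : disk (coord l z).
Proof.
have /set_mem/moment_angle_setP[F _ /(_ l)] := valP z.
by rewrite /coord; case: ifP => // _ /circle_disk.
Qed.

(** If [z] is on the circle at some [i] in [S], every coordinate outside [S]
    would be longer than 1, so [S] contains all vertices.  Otherwise the face
    that carries [z] contains [S]. *)
Lemma dominated_face S z : S \in faces K -> dominated S z -> exists F,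
  [/\ F \in faces K, S \subset F
    & forall i, if i \in F then disk (coord i z) else circle (coord i z)].
Proof.
move=> SK [zS z0]; have [/forallP ST|/forallPn[l lS]] := boolP [forall l, l \in S].
  exists S; split=> // i; rewrite ST; exact: coord_disk.
have /set_mem/moment_angle_setP[F FK zF] := valP z.
exists F; split=> //; apply/fintype.subsetP => i iS; apply: contraT => iF.
have := zF i; rewrite (negPf iF) circleE => i1.
have := zS i l iS lS; rewrite /coord i1 ltNge.
by have := coord_disk l z; rewrite diskE => ->.
Qed.

(** In the first period, all happens within the polydisk of a face containing
    [S].  Later at most one coordinate is off the circle, and a single vertex
    is a face. *)
Lemma contraction_path_moment_angle S z t : S \in faces K -> dominated S z ->
  moment_angle_set K (contraction_path S (z, t)).
Proof.
move=> SK zS; apply/moment_angle_setP; rewrite /contraction_path /=.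
set T := n.+1%:R * t; have z0 := zS.2.
have [T1|/ltW T1] := leP T 1.
  have [F [FK SF zF]] := dominated_face SK zS; exists F => // i.
  rewrite (@clamp_le0 (T - _)) ?slide0; last first.
    by rewrite subr_le0 (le_trans T1) // ler1n.
  have [iS|iS] := boolP (i \in S).
    rewrite (fintype.subsetP SF) //; apply: slide_disk; first exact: clamp_itv.
    exact: coord_disk.
  have := zF i; case: ifP => _; last exact: push_circle.
  by apply: push_disk; [exact: clamp_itv|exact: z0].
rewrite (clamp_ge1 T1).
pose p l := if l \in S then slide 1 (coord l z) else push 1 (coord l z).
have pc l : circle (p l).
  rewrite /p; case: ifP => [_|/negbT lS]; last exact/push1_circle/z0.
  by rewrite slide1 circleE /sqnorm /= expr1n expr0n addr0.
have p1 l : circle (slide 1 (p l)).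
  by rewrite slide1 circleE /sqnorm /= expr1n expr0n addr0.
have [l /andP[l0 l1]|no] := pickP (fun l : 'I_n => 0 < T - l.+1%:R < 1).
  exists (finset.set1 l); first exact: faces1.
  move=> i; rewrite inE; case: eqP => [_|/eqP il].
    by apply: slide_disk; [exact: clamp_itv|exact/circle_disk/pc].
  have [ltil|ltli] : (i < l \/ l < i)%N by move: il; rewrite -val_eqE /=; lia.
    rewrite (@clamp_ge1 (T - i.+1%:R)); first exact: p1.
    have : i.+2%:R <= l.+1%:R :> R by rewrite ler_nat.
    rewrite -natr1; lra.
  rewrite (@clamp_le0 (T - i.+1%:R)) ?slide0; first exact: pc.
  have : l.+2%:R <= i.+1%:R :> R by rewrite ler_nat.
  rewrite -[l.+2%:R]natr1; lra.
exists finset.set0; first exact: faces0.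
move=> i; rewrite inE; move/negbT: (no i); rewrite negb_and -!leNgt.
case/orP => Ti; first by rewrite clamp_le0 // slide0; exact: pc.
by rewrite clamp_ge1 //; exact: p1.
Qed.

(** The default value of [insubd] occurs only outside [dominated S]. *)
Definition contraction S (p : Z * R) : Z :=
  insubd p.1 (contraction_path S p : {ptws 'I_n -> (R * R)%type}).

Lemma val_contraction S z t : S \in faces K -> dominated S z ->
  \val (contraction S (z, t)) = contraction_path S (z, t).
Proof.
move=> SK zS; apply: insubdK; rewrite unfold_in.
by apply/mem_set; exact: contraction_path_moment_angle.
Qed.

Lemma basepoint_ex : exists c : Z, \val c = (fun=> (1, 0)) :> ('I_n -> (R * R)%type).
Proof.
have bK : (fun=> (1, 0)) \in @moment_angle_set R n K.
  apply/mem_set/moment_angle_setP; exists finset.set0; first exact: faces0.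
  by move=> i; rewrite inE circleE /sqnorm /= expr1n expr0n addr0.
by exists (exist (fun f => f \in @moment_angle_set R n K) _ bK).
Qed.

Lemma dominated_contracts (c : Z) S : \val c = (fun=> (1, 0)) :> ('I_n -> (R * R)%type) ->
  S \in faces K -> contracts_to R c (dominated S).
Proof.
move=> cE SK; exists (contraction S); split=> [|z zS|z zS]; last 2 first.
- by apply: val_inj; rewrite val_contraction // contraction_path0.
- by apply: val_inj; rewrite val_contraction // contraction_path1 cE.
apply/subspace_continuousP => -[z t] [/= zS t01].
apply: cvg_coord => l; rewrite /coord val_contraction //.
set D := _ `*` _.
have : (fun p : Z * R => contraction_path S p l) @ within D (nbhs (z, t)) -->
    contraction_path S (z, t) l.
  have c1 : fst @ within D (nbhs (z, t)) --> z.
    by apply: (cvg_trans _ (@cvg_fst _ _ (nbhs z) (nbhs t) _)); exact/cvg_app/cvg_within.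
  have c2 : snd @ within D (nbhs (z, t)) --> t.
    by apply: (cvg_trans _ (@cvg_snd _ _ (nbhs z) (nbhs t) _)); exact/cvg_app/cvg_within.
  have cl : (fun p : Z * R => coord l p.1) @ within D (nbhs (z, t)) --> coord l z.
    by apply: (cvg_comp _ _ c1); exact: coord_continuous.
  have cT : (fun p : Z * R => n.+1%:R * p.2) @ within D (nbhs (z, t)) --> n.+1%:R * t.
    by apply: cvgM => //; exact: cvg_cst.
  have ct : clamp (n.+1%:R * p.2 - l.+1%:R) @[p --> within D (nbhs (z, t))] -->
      clamp (n.+1%:R * t - l.+1%:R).
    by apply: cvg_clamp; apply: cvgB => //; exact: cvg_cst.
  rewrite /contraction_path /=; apply: (cvg_slide ct).
  have [lS|lS] := boolP (l \in S); first exact: (cvg_slide (cvg_clamp cT) cl).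
  exact: (cvg_push (zS.2 l lS) (cvg_clamp cT) cl).
apply: cvg_trans; apply: near_eq_cvg; rewrite /prop_near1 /=.
suff : \forall p \near (z, t), D p -> contraction_path S p l = coord l (contraction S p) by [].
have FF : Filter (nbhs (z, t)) by exact: nbhs_filter.
apply: (filterS _ (@filterT _ _ FF)) => -[y u] _ [/= yS _].
by rewrite /coord val_contraction.
Qed.


(** Distinct faces of the same size have vertices [i] in the first only and [l]
    in the second only, and [z_i] and [z_l] cannot each be the shorter. *)
Lemma trivIset_dominated q :
  trivIset [set S | S \in faces K /\ #|S| = q] dominated.
Proof.
move=> S F [_ Ss] [_ Fs] [z [[zS _] [zF _]]].
apply/eqP; rewrite eqEcard Ss Fs leqnn andbT; apply/fintype.subsetPn => -[i iS iF].
have [l lF lS] : exists2 l, l \in F & l \notin S.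
  apply/fintype.subsetPn; apply: contra iF => FS.
  suff -> : F = S by [].
  by apply/eqP; rewrite eqEcard FS Ss Fs leqnn.
by have := zS i l iS lS; rewrite ltNge => /negP[]; exact: ltW (zF l i lF iF).
Qed.

(** The zero set is a face: on the circle no coordinate vanishes. *)
Lemma zero_set_dominated z : let S := [set i | sqnorm (coord i z) == 0]%SET in
  S \in faces K /\ dominated S z.
Proof.
move=> S; split; last first.
  have lpos l : l \notin S -> 0 < sqnorm (coord l z).
    by rewrite inE => l0; rewrite lt_neqAle eq_sym l0 sqnorm_ge0.
  by split=> // i l; rewrite {1}inE => /eqP ->; exact: lpos.
have /set_mem/moment_angle_setP[F FK zF] := valP z.
apply: (facesS _ FK); apply/fintype.subsetP => i; rewrite inE => /eqP i0.
apply: contraT => iF; have := zF i; rewrite (negPf iF) circleE.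
by move: i0; rewrite /coord => -> /esym/eqP; rewrite oner_eq0.
Qed.

(** The open sets are grouped by the number of vertices of the face, which
    makes them disjoint within each group. *)
Lemma categorical_cover_faces m : (forall F, F \in faces K -> (#|F| <= m)%N) ->
  categorical_cover R Z m.
Proof.
move=> Km; have [c cE] := basepoint_ex.
pose P q := [set S : {set 'I_n} | S \in faces K /\ #|S| = q].
exists (fun q : 'I_m.+1 => \bigcup_(S in P q) dominated S); split.
- by move=> q; apply: bigcup_open => S _; exact: open_dominated.
- move=> q; have [||S [SK _]|H [Hc H0 H1]] := @contracts_to_bigcup R Z c _ (P q) dominated.
  + by move=> S _; exact: open_dominated.
  + exact: trivIset_dominated.
  + exact: dominated_contracts.
  + by exists H, c.
- rewrite -subTset => z _; have [SK zS] := zero_set_dominated z.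
  set S := (X in X \in _) in SK zS.
  have Sm : (#|S| < m.+1)%N by rewrite ltnS Km.
  by exists (Ordinal Sm) => //; exists S.
Qed.

End MomentAngleContractions.

Theorem theorem1p8 (R : realType) (n : nat) (e : rel 'I_n)
    (e_sym : symmetric e) (e_irr : irreflexive e) :
  (exists k, is_cat R (moment_angle R (graph_complex e)) k /\ (k <= 2)%N) /\
  annihilating (graph_complex e) 2 /\
  (forall (k : nat) (w : nat -> Tor (graph_complex e)), (2 <= k)%N ->
     (forall i, (1 <= i <= k)%N -> decomposable (w i)) ->
     massey_vanishes k w).
Proof.
split; last by split; [exact: graph_annihilating|exact: graph_massey_decomposable].
have cat2 : categorical_cover R (moment_angle R (graph_complex e)) 2.
  by apply: categorical_cover_faces; exact: graph_faces_card.
have ex : exists l, `[< categorical_cover R (moment_angle R (graph_complex e)) l >].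
  by exists 2%N; exact/asboolP.
exists (ex_minn ex); case: ex_minnP => l /asboolP lcat lmin.
split; last by apply: lmin; exact/asboolP.
by split=> // l' /asboolP; exact: lmin.
Qed.
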